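(* Let $M$ be a smooth compact Riemannian manifold without boundary, let $f: M\to M$ be a $C^{1+\theta}$-expanding endomorphism, and let $y\in M$. Suppose that $f$ is conformal, i.e., for each $x\in M$, the derivative map $D_xf:T_xM\to T_{f(x)}M$ is a scalar multiple of an isometry. Then the set $$E(f,y)=\{z\in M: y\notin \overline{\{f^k(z): k\in\mathbb{N}\}}\}$$ is absolute winning.
   Context: Here $\mathbb{N}=\{0,1,2,\dots\}$. A $C^{1+\theta}$-expanding endomorphism ($\theta>0$) is a $C^1$ map $f:M\to M$ with $\theta$-Hölder derivative for which there are constants $1<\sigma_1\le\sigma_2$ with $\sigma_1\|v\|\le\|D_xf v\|\le\sigma_2\|v\|$ for all $x\in M$, $v\in T_xM$. Absolute game on $\mathbb{R}^d$: fix $0<\beta<1/3$ and a target set $S\subset\mathbb{R}^d$. Bob initially chooses a closed ball $B_1=B(x_1,\rho_1)$, $\rho_1>0$. In each turn, after Bob has chosen a closed ball $B_i=B(x_i,\rho_i)$, Alice chooses a point $L_i\in\mathbb{R}^d$ (a $0$-dimensional affine subspace) and removes its $\epsilon_i$-neighborhood $L_i^{(\epsilon_i)}$ from $B_i$, for some $0<\epsilon_i\le\beta\rho_i$; then Bob chooses a closed ball $B_{i+1}\subset B_i\setminus L_i^{(\epsilon_i)}$ of radius $\rho_{i+1}\ge\beta\rho_i$. Alice wins if and only if $\bigcap_{i=1}^\infty B_i\cap S\ne\emptyset$. $S$ is ($0$-dimensionally) $\beta$-absolute winning if Alice has a winning strategy, and absolute winning if it is $\beta$-absolute winning for every $0<\beta<1/3$.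 Absolute winning on a manifold: for $U\subset\mathbb{R}^d$ open, a set $S\subset U$ is absolute winning on $U$ if, for every $0<\beta<1/3$, Alice has a winning strategy in the absolute game on $\mathbb{R}^d$ with parameter $\beta$ and target set $S$ when Bob is required to choose $B_1\subset U$. A subset $S$ of a $d$-dimensional manifold $M$ is absolute winning if there is a collection of coordinate charts $(U_i,\varphi_i)$ covering $M$ such that $\varphi_i(S\cap U_i)$ is absolute winning on $\varphi_i(U_i)$ for every $i$ (this does not depend on the choice of charts, by invariance of absolute winning under $C^1$ diffeomorphisms). *)

(* Defs.v *)
From mathcomp Require Import all_boot all_order all_algebra.
From mathcomp Require Import all_classical all_reals all_analysis.

Set Implicit Arguments.
Unset Strict Implicit.
Unset Printing Implicit Defensive.

Import Order.TTheory GRing.Theory Num.Theory.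
Import numFieldNormedType.Exports.

Local Open Scope classical_set_scope.
Local Open Scope ring_scope.

(* C^n regularity on an open set U.  F is a total function whose values outside
   U are irrelevant. *)
Fixpoint Cn_on (R : realType) (V W : normedModType R) (n : nat) (U : set V)
    (F : V -> W) : Prop :=
  match n with
  | 0%N => forall p, U p -> {for p, continuous F}
  | m.+1 => (forall p, U p -> differentiable F p) /\
            (forall v : V, Cn_on m U (fun p => 'D_v F p))
  end.

Definition smooth_on (R : realType) (V W : normedModType R) (U : set V)
    (F : V -> W) : Prop :=
  forall n, Cn_on n U F.

(* F is differentiable on U with locally theta-Hölder derivative.  On a compact
   manifold covered by charts, this is the chart form of a Hölder derivative. *)
Definition holder_derivative_on (R : realType) (V W : normedModType R)
    (theta : R) (U : set V) (F : V -> W) : Prop :=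
  forall p, U p -> exists (C : R) (N : set V), nbhs p N /\
    forall q q' v, (U `&` N) q -> (U `&` N) q' ->
      `|'d F q v - 'd F q' v| <= C * `|q - q'| `^ theta * `|v|.

(** * Smooth manifolds *)

(* The coordinate map and its inverse are total functions; only the values on
   the domain, resp. on the image of the domain, are meaningful. *)
Record chart (R : realType) (d : nat) (M : topologicalType) := Chart {
  chart_dom : set M ;
  chart_fun :> M -> 'rV[R]_d ;
  chart_inv : 'rV[R]_d -> M ;
  chart_dom_open : open chart_dom ;
  chart_img_open : open (chart_fun @` chart_dom) ;
  chart_funK : forall x, chart_dom x -> chart_inv (chart_fun x) = x ;
  chart_fun_continuous :
    forall x, chart_dom x -> {for x, continuous chart_fun} ;
  chart_inv_continuous :
    forall p, (chart_fun @` chart_dom) p -> {for p, continuous chart_inv}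
}.

Definition chart_img (R : realType) (d : nat) (M : topologicalType)
    (c : chart R d M) : set 'rV[R]_d :=
  c @` chart_dom c.

Definition transition (R : realType) (d : nat) (M : topologicalType)
    (c c' : chart R d M) : 'rV[R]_d -> 'rV[R]_d :=
  c' \o chart_inv c.

Definition smoothly_compatible (R : realType) (d : nat) (M : topologicalType)
    (c c' : chart R d M) : Prop :=
  smooth_on (c @` (chart_dom c `&` chart_dom c')) (transition c c') /\
  smooth_on (c' @` (chart_dom c `&` chart_dom c')) (transition c' c).

(* The atlas need not be maximal; see [coordinate_chart]. *)
Record smooth_manifold (R : realType) (d : nat) := SmoothManifold {
  carrier :> topologicalType ;
  atlas : set (chart R d carrier) ;
  carrier_hausdorff : hausdorff_space carrier ;
  carrier_second_countable : @second_countable carrier ;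
  atlas_cover : forall x : carrier, exists2 c, atlas c & chart_dom c x ;
  atlas_compatible :
    forall c c', atlas c -> atlas c' -> smoothly_compatible c c'
}.
Arguments atlas {R d} _ _.

(* The charts of the smooth structure, i.e. of the maximal atlas. *)
Definition coordinate_chart (R : realType) (d : nat) (M : smooth_manifold R d)
    (c : chart R d M) : Prop :=
  forall c', atlas M c' -> smoothly_compatible c c'.

(** * Riemannian metrics *)

Definition gram_form (R : realType) (d : nat) (G : 'M[R]_d)
    (v w : 'rV[R]_d) : R :=
  (v *m G *m w^T) 0 0.

(* A tangent vector at x is represented, in a chart c at x, by a row vector, two
   representatives in charts c and c' being identified by the derivative at c x
   of the transition map.  Accordingly a metric is a family of Gram matrices
   [metric c p], p in [chart_img c], related by these derivatives. *)
Record riemannian_metric (R : realType) (d : nat) (M : smooth_manifold R d) :=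
  RiemannianMetric {
  metric :> chart R d M -> 'rV[R]_d -> 'M[R]_d ;
  metric_smooth : forall c, atlas M c -> smooth_on (chart_img c) (metric c) ;
  metric_sym : forall c p, atlas M c -> chart_img c p ->
    (metric c p)^T = metric c p ;
  metric_posdef : forall c p, atlas M c -> chart_img c p ->
    forall v : 'rV[R]_d, v != 0 -> 0 < gram_form (metric c p) v v ;
  metric_change : forall c c' x, atlas M c -> atlas M c' ->
    chart_dom c x -> chart_dom c' x -> forall v w : 'rV[R]_d,
    gram_form (metric c' (c' x))
      ('d (transition c c') (c x) v) ('d (transition c c') (c x) w)
    = gram_form (metric c (c x)) v w
}.

(* Norm of the tangent vector at x represented by v in the chart c. *)
Definition tangent_norm (R : realType) (d : nat) (M : smooth_manifold R d)
    (g : riemannian_metric M) (c : chart R d M) (x : M) (v : 'rV[R]_d) : R :=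
  Num.sqrt (gram_form (g c (c x)) v v).

(** * Expanding conformal endomorphisms *)

Definition local_expr (R : realType) (d : nat) (M : smooth_manifold R d)
    (f : M -> M) (c c' : chart R d M) : 'rV[R]_d -> 'rV[R]_d :=
  c' \o f \o chart_inv c.

(* D_x f read in a chart c at x and a chart c' at f x. *)
Definition tangent_map (R : realType) (d : nat) (M : smooth_manifold R d)
    (f : M -> M) (c c' : chart R d M) (x : M) : 'rV[R]_d -> 'rV[R]_d :=
  'd (local_expr f c c') (c x).

Definition C1_holder (R : realType) (d : nat) (M : smooth_manifold R d)
    (theta : R) (f : M -> M) : Prop :=
  continuous f /\
  forall c c', atlas M c -> atlas M c' ->
    let U := c @` (chart_dom c `&` f @^-1` chart_dom c') in
    Cn_on 1 U (local_expr f c c') /\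
    holder_derivative_on theta U (local_expr f c c').

Definition expanding_endomorphism (R : realType) (d : nat)
    (M : smooth_manifold R d) (g : riemannian_metric M) (theta : R)
    (f : M -> M) : Prop :=
  C1_holder theta f /\
  exists s1 s2 : R, [/\ 1 < s1, s1 <= s2 &
    forall x c c', atlas M c -> atlas M c' ->
      chart_dom c x -> chart_dom c' (f x) -> forall v,
      s1 * tangent_norm g c x v
        <= tangent_norm g c' (f x) (tangent_map f c c' x v)
        <= s2 * tangent_norm g c x v].

Definition conformal (R : realType) (d : nat) (M : smooth_manifold R d)
    (g : riemannian_metric M) (f : M -> M) : Prop :=
  forall x c c', atlas M c -> atlas M c' ->
    chart_dom c x -> chart_dom c' (f x) ->
    exists (a : R) (T : {linear 'rV[R]_d -> 'rV[R]_d}),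
      (forall v, tangent_norm g c' (f x) (T v) = tangent_norm g c x v) /\
      (forall v, tangent_map f c c' x v = a *: T v).

(** * The absolute game *)

(* The library norm on ['rV[R]_d] is the sup norm; the balls of the game are
   Euclidean. *)
Definition enorm (R : realType) (d : nat) (v : 'rV[R]_d) : R :=
  Num.sqrt (\sum_(i < d) v 0 i ^+ 2).

(* A pair (x, r) stands for a ball in Bob's moves, and for the point x together
   with the size r of its removed neighbourhood in Alice's moves. *)
Definition cball (R : realType) (d : nat) (b : 'rV[R]_d * R) : set 'rV[R]_d :=
  [set z | enorm (z - b.1) <= b.2].

Definition point_nbhd (R : realType) (d : nat) (a : 'rV[R]_d * R) :
    set 'rV[R]_d :=
  [set z | enorm (z - a.1) < a.2].

(* Alice's next move as a function of the nonempty list of Bob's balls so far,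
   in chronological order. *)
Definition strategy (R : realType) (d : nat) : Type :=
  seq ('rV[R]_d * R) -> 'rV[R]_d * R.

Definition legal_strategy (R : realType) (d : nat) (beta : R)
    (sigma : strategy R d) : Prop :=
  forall (s : seq ('rV[R]_d * R)) (b : 'rV[R]_d * R),
    0 < b.2 -> 0 < (sigma (rcons s b)).2 <= beta * b.2.

(* Balls are numbered from 0.  For d >= 1 and beta < 1/3 Bob always has a legal
   move, so considering infinite plays only loses nothing; for d = 0 Bob is
   stuck after Alice's first move, and there is no play. *)
Definition legal_play (R : realType) (d : nat) (beta : R) (U : set 'rV[R]_d)
    (sigma : strategy R d) (B : nat -> 'rV[R]_d * R) : Prop :=
  [/\ 0 < (B 0%N).2, cball (B 0%N) `<=` U &
   forall i, beta * (B i).2 <= (B i.+1).2 /\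
     cball (B i.+1) `<=` cball (B i) `\` point_nbhd (sigma (mkseq B i.+1))].

Definition absolute_winning_on (R : realType) (d : nat)
    (U S : set 'rV[R]_d) : Prop :=
  forall beta : R, 0 < beta -> beta < 1 / 3 ->
    exists2 sigma : strategy R d, legal_strategy beta sigma &
      forall B, legal_play beta U sigma B ->
        (\bigcap_i cball (B i)) `&` S !=set0.

Definition absolute_winning (R : realType) (d : nat) (M : smooth_manifold R d)
    (S : set M) : Prop :=
  exists C : set (chart R d M),
    [/\ forall c, C c -> coordinate_chart c,
        forall x, exists2 c, C c & chart_dom c x &
        forall c, C c ->
          absolute_winning_on (chart_img c) (c @` (S `&` chart_dom c))].

Definition orbit_avoiding (M : topologicalType) (f : M -> M) (y : M) :
    set M :=
  [set z | ~ closure (range (fun k : nat => iter k f z)) y].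

(* Main.v *)
Require Import Defs.
From mathcomp Require Import all_boot all_order all_algebra.
From mathcomp Require Import all_classical all_reals all_analysis.
From mathcomp Require Import ring lra.
Import Order.TTheory GRing.Theory Num.Theory.
Import numFieldNormedType.Exports.
Local Open Scope classical_set_scope.
Local Open Scope ring_scope.

Set Implicit Arguments.
Unset Strict Implicit.

(* Since f is conformal and expanding, a ball B of small radius rho around x is
   mapped by f^k, as long as Lam_k(x) * rho <= delta, with distortion bounded by
   the factor 2, where Lam_k(x) is the product of the conformal factors along
   the orbit of x: the relative errors at time i, as seen from time k, decay
   like s1^(-theta (k - i)), so their sum is finite.  Take k maximal for B, over
   all x in B; the image of B then has size comparable to delta.  If delta is
   small compared with the distances between the distinct points among
   y, f y, ..., f^N y, this image meets a tiny neighbourhood of at most one of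
   them, so that one removed ball of radius beta * rho prevents f^j z from being
   close to y for every time j in [k - N, k].  Maximising over x in B makes it
   unnecessary to compare Lam_k at different points: from one move to the next k
   grows by at most N as soon as beta * s1^N >= 1.  Finally N is chosen, before
   delta, so large that the first k is at most N. *)

(** * Neighbourhoods, compactness and growth of powers *)

Lemma nbhs_dist_lt (R : realType) (V : normedModType R) (v : V) (e : R) :
  0 < e -> nbhs v [set w | `|v - w| < e].
Proof. by move=> e0; apply/nbhs_normP; exists e. Qed.

Lemma nbhs_dist_ex (R : realType) (V : normedModType R) (v : V) (P : set V) :
  nbhs v P -> exists2 e : R, 0 < e & forall w, `|v - w| < e -> P w.
Proof. by move=> /nbhs_normP[e /= e0 He]; exists e. Qed.

Lemma near_right_ex (R : realType) (P : R -> Prop) :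
  (\forall e \near 0^'+, P e) -> exists2 e, 0 < e & P e.
Proof.
move=> H; near (0:R)^'+ => e; exists e => //; near: e; exact: H.
Unshelve. all: by end_near. Qed.

Lemma near_right_le (R : realType) (P : R -> Prop) (e0 : R) : 0 < e0 ->
  (forall e, 0 < e -> e <= e0 -> P e) -> \forall e \near 0^'+, P e.
Proof.
move=> e00 H; near=> e; apply: H; first by [].
by near: e; exact: nbhs_right_le.
Unshelve. all: by end_near. Qed.

(** Compactness merges the local thresholds [e0] into one. The conclusion is kept eventual, so that
    finitely many such conditions can later be intersected. *)
Lemma compact_uniform_near (R : realType) (T : topologicalType) (K : set T)
    (P : R -> T -> Prop) : compact K ->
  (forall x0, K x0 -> exists2 U, nbhs x0 U & exists2 e0 : R, 0 < e0 &
     forall x e, U x -> K x -> 0 < e -> e <= e0 -> P e x) ->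
  \forall e \near 0^'+, forall x, K x -> P e x.
Proof.
move=> /compact_near_coveringP/near_covering_withinP cov loc.
apply: cov => x0 /loc[U x0U [e0 e00 H]].
exists (U, [set e | 0 < e <= e0]) => [|[x e] /= [Ux /andP[? ?]] Kx]; last exact: H.
split=> //=; near=> e; apply/andP; split=> //; near: e; exact: nbhs_right_le.
Unshelve. all: by end_near. Qed.

Lemma compact_finite_nbhs_cover (M : topologicalType) (K : M -> set M) :
  compact [set: M] -> (forall p, nbhs p (K p)) ->
  exists D : seq M, forall x, exists2 p, p \in D & K p x.
Proof.
move=> /compact_near_coveringP cov Knbhs.
(* A set is large for [F] when it contains all extensions of some list; near-covering compactness
   along [F] produces one list that works for every point. *)
pose F : set_system (seq M) :=
  [set S | exists D0 : seq M, forall D : seq M, {subset D0 <= D} -> S D].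
have FF : Filter F.
  split=> [|S S' [D0 H0] [D1 H1]|S S' SS' [D0 H0]]; first by exists [::].
    exists (D0 ++ D1) => D sub; split; [apply: H0|apply: H1] => x xD.
      by apply: sub; rewrite mem_cat xD.
    by apply: sub; rewrite mem_cat xD orbT.
  by exists D0 => D /H0; exact: SS'.
have [|D0 HD0] := cov _ F (fun (D : seq M) x => exists2 p, p \in D & K p x) FF.
  move=> x _; exists (K x, [set D : seq M | x \in D]); last first.
    by move=> [x' D] /= [Kx' xD]; exists x.
  split=> /=; first exact: Knbhs.
  by exists [:: x] => D; apply; rewrite inE.
by exists D0 => x; exact: (HD0 D0 _ x I).
Qed.

Lemma expr_unbounded (R : realType) (s x : R) : 1 < s -> exists n, x < s ^+ n.
Proof.
move=> s1; have bern n : 1 + n%:R * (s - 1) <= s ^+ n.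
  elim: n => [|n IH]; first by rewrite mul0r addr0 expr0.
  have n0 : 0 <= n%:R :> R by [].
  have : s * (1 + n%:R * (s - 1)) <= s * s ^+ n by rewrite ler_wpM2l //; lra.
  rewrite exprS -natr1; apply: le_trans.
  have : 0 <= n%:R * ((s - 1) * (s - 1)) by rewrite mulr_ge0 ?mulr_ge0 //; lra.
  by lra.
have [n _ nx] : exists2 n : nat, True & x / (s - 1) < n%:R.
  have [x0|x0] := ltP x 0; last first.
    exists (Num.bound (x / (s - 1))) => //; apply: archi_boundP.
    by apply: divr_ge0 => //; rewrite subr_ge0 ltW.
  by exists 0%N => //; rewrite pmulr_llt0 // invr_gt0 subr_gt0.
exists n; apply: lt_le_trans (bern n).
by move: nx; rewrite ltr_pdivrMr ?subr_gt0 //; lra.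
Qed.

(** * Gram forms and the two norms on row vectors *)

Lemma gram_formDl (R : realType) (d : nat) (G : 'M[R]_d) u v w :
  gram_form G (u + v) w = gram_form G u w + gram_form G v w.
Proof. by rewrite /gram_form !mulmxDl mxE. Qed.

Lemma gram_formDr (R : realType) (d : nat) (G : 'M[R]_d) u v w :
  gram_form G u (v + w) = gram_form G u v + gram_form G u w.
Proof. by rewrite /gram_form linearD /= mulmxDr mxE. Qed.

Lemma gram_formZl (R : realType) (d : nat) (G : 'M[R]_d) a v w :
  gram_form G (a *: v) w = a * gram_form G v w.
Proof. by rewrite /gram_form -!scalemxAl mxE. Qed.

Lemma gram_formZr (R : realType) (d : nat) (G : 'M[R]_d) a v w :
  gram_form G v (a *: w) = a * gram_form G v w.
Proof. by rewrite /gram_form linearZ /= -scalemxAr mxE. Qed.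

Lemma gram_formC (R : realType) (d : nat) (G : 'M[R]_d) v w :
  G^T = G -> gram_form G v w = gram_form G w v.
Proof.
move=> Gsym; rewrite /gram_form -[LHS]mulr1.
have -> : (v *m G *m w^T) 0 0 = (v *m G *m w^T)^T 0 0 by rewrite [RHS]mxE.
by rewrite !trmx_mul trmxK Gsym mulmxA mulr1.
Qed.

Lemma gram_formE (R : realType) (d : nat) (G : 'M[R]_d) (v w : 'rV[R]_d) :
  gram_form G v w = \sum_j (\sum_i v 0 i * G i j) * w 0 j.
Proof.
by rewrite /gram_form !mxE; apply: eq_bigr => j _; rewrite !mxE.
Qed.

Definition posdef (R : realType) (d : nat) (G : 'M[R]_d) :=
  G^T = G /\ forall v : 'rV[R]_d, v != 0 -> 0 < gram_form G v v.

Definition gnorm (R : realType) (d : nat) (G : 'M[R]_d) (v : 'rV[R]_d) :=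
  Num.sqrt (gram_form G v v).

Section Gnorm.
Variables (R : realType) (d : nat) (G : 'M[R]_d).
Hypothesis Gpos : posdef G.

Lemma gram_form_ge0 v : 0 <= gram_form G v v.
Proof.
have [->|v0] := eqVneq v 0; last exact/ltW/Gpos.2.
by rewrite -(scale0r (0 : 'rV[R]_d)) gram_formZl mul0r.
Qed.

Lemma gram_form_CauchySchwarz v w :
  gram_form G v w ^+ 2 <= gram_form G v v * gram_form G w w.
Proof.
have [->|w0] := eqVneq w 0.
  by rewrite -(scale0r (0 : 'rV[R]_d)) !gram_formZr !mul0r mulr0 expr0n.
have c0 := Gpos.2 _ w0.
set a := gram_form G v v; set b := gram_form G v w; set c := gram_form G w w in c0 *.
have := gram_form_ge0 (c *: v + (- b) *: w).
rewrite gram_formDl !gram_formDr !gram_formZl !gram_formZr.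
rewrite (gram_formC w v Gpos.1) -/a -/b -/c.
have -> : c * (c * a) + c * (- b * b) + (- b * (c * b) + - b * (- b * c)) =
  c * (a * c - b ^+ 2) by ring.
by rewrite pmulr_rge0 // subr_ge0.
Qed.

Lemma gnorm_ge0 v : 0 <= gnorm G v.
Proof. exact: sqrtr_ge0. Qed.

Lemma gnormZ a v : gnorm G (a *: v) = `|a| * gnorm G v.
Proof.
rewrite /gnorm gram_formZl gram_formZr mulrA -expr2.
by rewrite sqrtrM ?sqr_ge0 // sqrtr_sqr.
Qed.

Lemma gnormN v : gnorm G (- v) = gnorm G v.
Proof. by rewrite -scaleN1r gnormZ normrN normr1 mul1r. Qed.

Lemma gnorm_triangle v w : gnorm G (v + w) <= gnorm G v + gnorm G w.
Proof.
rewrite -(@ler_pXn2r _ 2) ?nnegrE ?addr_ge0 ?gnorm_ge0 //.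
rewrite /gnorm sqrrD !sqr_sqrtr ?gram_form_ge0 //.
rewrite gram_formDl !gram_formDr (gram_formC w v Gpos.1).
set b := gram_form G v w.
suff: b <= Num.sqrt (gram_form G v v) * Num.sqrt (gram_form G w w).
  by move=> H; rewrite -mulr_natl; lra.
apply: (le_trans (ler_norm _)); rewrite -sqrtrM ?gram_form_ge0 //.
by rewrite -sqrtr_sqr ler_wsqrtr // gram_form_CauchySchwarz.
Qed.

Lemma gnorm_dist v w : `|gnorm G v - gnorm G w| <= gnorm G (v - w).
Proof.
have H1 := gnorm_triangle (v - w) w; have H2 := gnorm_triangle (w - v) v.
rewrite subrK in H1; rewrite subrK -opprB gnormN in H2.
by rewrite ler_norml; lra.
Qed.

End Gnorm.

Lemma posdef1 (R : realType) (d : nat) : posdef (1%:M : 'M[R]_d).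
Proof.
split=> [|v]; first by rewrite trmx1.
rewrite /gram_form mulmx1 !mxE => v0.
have : 0 <= \sum_i v 0 i * v^T i 0.
  by apply: sumr_ge0 => i _; rewrite mxE -expr2 sqr_ge0.
rewrite le_eqVlt => /predU1P[/esym/eqP|//].
rewrite psumr_eq0 => [/allP v00|i _]; last by rewrite mxE -expr2 sqr_ge0.
case/negP: v0; apply/eqP/rowP => i; rewrite mxE.
by have := v00 i (mem_index_enum _); rewrite mxE -expr2 sqrf_eq0 => /eqP.
Qed.

Lemma enormE (R : realType) (d : nat) (v : 'rV[R]_d) : enorm v = gnorm 1%:M v.
Proof.
rewrite /enorm /gnorm /gram_form mulmx1 !mxE.
by congr Num.sqrt; apply: eq_bigr => i _; rewrite mxE expr2.
Qed.

Lemma coord_le_norm (R : realType) (d : nat) (v : 'rV[R]_d) i : `|v 0 i| <= `|v|.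
Proof.
rewrite [leRHS]/Num.norm /= mx_normrE; apply/bigmax_geP; right => /=.
by exists (0, i).
Qed.

Lemma norm_le_coord (R : realType) (d : nat) (v : 'rV[R]_d) m : 0 <= m ->
  (forall i, `|v 0 i| <= m) -> `|v| <= m.
Proof.
move=> m0 H; rewrite [leLHS]/Num.norm /= mx_normrE; apply/bigmax_leP; split => //.
by move=> [i j] _ /=; rewrite (ord1 i).
Qed.

Lemma norm_le_enorm (R : realType) (d : nat) (v : 'rV[R]_d) : `|v| <= enorm v.
Proof.
apply: norm_le_coord => [|i]; first exact: sqrtr_ge0.
rewrite -sqrtr_sqr ler_wsqrtr // (bigD1 i) //= lerDl.
by apply: sumr_ge0 => j _; exact: sqr_ge0.
Qed.

(** The factor [d.+1] is cruder than the square root of the dimension, but it is positive even for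
    [d = 0], so that one can divide by it. *)
Lemma enorm_le_norm (R : realType) (d : nat) (v : 'rV[R]_d) :
  enorm v <= d.+1%:R * `|v|.
Proof.
rewrite -[leRHS]ger0_norm ?mulr_ge0 // -sqrtr_sqr ler_wsqrtr //.
apply: (@le_trans _ _ (\sum_(i < d) `|v| ^+ 2)).
  apply: ler_sum => i _; rewrite -[leLHS]ger0_norm ?sqr_ge0 // normrX.
  by rewrite lerXn2r ?nnegrE // coord_le_norm.
rewrite sumr_const card_ord -[leLHS]mulr_natl exprMn ler_wpM2r ?sqr_ge0 //.
by rewrite -natrX ler_nat expnS expn1; apply: (leq_trans (leqnSn d)); exact: leq_pmulr.
Qed.

Section Norms.
Variables (R : realType) (d : nat).

Lemma gram_form_le_norm (G : 'M[R]_d) (v : 'rV[R]_d) :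
  `|gram_form G v v| <= d%:R ^+ 2 * `|G| * `|v| ^+ 2.
Proof.
have GE i j : `|G i j| <= `|G|.
  rewrite [leRHS]/Num.norm /= mx_normrE; apply/bigmax_geP; right => /=.
  by exists (i, j).
rewrite gram_formE; apply: (le_trans (ler_norm_sum _ _ _)).
apply: (@le_trans _ _ (\sum_(j < d) \sum_(i < d) `|G| * `|v| ^+ 2)).
  apply: ler_sum => j _; rewrite mulr_suml; apply: (le_trans (ler_norm_sum _ _ _)).
  apply: ler_sum => i _; rewrite !normrM.
  have -> : `|G| * `|v| ^+ 2 = `|v| * `|G| * `|v| by ring.
  apply: ler_pM; rewrite ?mulr_ge0 ?coord_le_norm //.
  by apply: ler_pM => //; exact: coord_le_norm.
rewrite !sumr_const !card_ord -!mulrnA -[leLHS]mulr_natl natrM.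
by rewrite expr2 !mulrA.
Qed.

Lemma gnorm_le_norm (G : 'M[R]_d) : exists2 A : R, 0 < A &
  forall v, gnorm G v <= A * `|v|.
Proof.
exists (Num.sqrt (d%:R ^+ 2 * `|G|) + 1) => [|v].
  by rewrite ltr_wpDl // sqrtr_ge0.
apply: (@le_trans _ _ (Num.sqrt (d%:R ^+ 2 * `|G|) * `|v|)); last first.
  by rewrite ler_wpM2r // lerDl.
rewrite -[X in _ * X]ger0_norm // -sqrtr_sqr -sqrtrM ?mulr_ge0 ?sqr_ge0 //.
by rewrite ler_wsqrtr // (le_trans (ler_norm _)) // gram_form_le_norm.
Qed.

Lemma sphere_compact : compact [set v : 'rV[R]_d | `|v| = 1].
Proof.
apply: bounded_closed_compact.
  by exists 1; split=> [|M HM v /= ->]; [exact: num_real|exact: ltW].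
move=> v vcl /=; apply/eqP; rewrite -subr_eq0 -normr_le0 leNgt; apply/negP => e0.
have [|w [/= w1 vw]] := vcl [set w | `|v - w| < `| `|v| - 1|].
  exact: nbhs_dist_lt.
by move: vw; rewrite ltNge -w1 ler_dist_dist.
Qed.

(** The norm of [G] is continuous and positive on the compact unit sphere of the sup norm, hence
    bounded below there; homogeneity does the rest. *)
Lemma norm_le_gnorm (G : 'M[R]_d) : posdef G -> exists2 m : R, 0 < m &
  forall v, m * `|v| ^+ 2 <= gram_form G v v.
Proof.
move=> Gpos; have [A A0 HA] := gnorm_le_norm G.
have [m m0 Hm] : exists2 m : R, 0 < m &
    forall v : 'rV[R]_d, `|v| = 1 -> m <= gnorm G v.
  apply: near_right_ex.
  apply: (compact_uniform_near (P := fun e v => e <= gnorm G v) sphere_compact).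
  move=> v0 /= v01; have g0 : 0 < gnorm G v0.
    by rewrite sqrtr_gt0; apply: Gpos.2; rewrite -normr_gt0 v01.
  exists [set w | `|v0 - w| < gnorm G v0 / (2 * A)].
    by apply: nbhs_dist_lt; rewrite divr_gt0 ?mulr_gt0.
  exists (gnorm G v0 / 2) => [|w e /= vw _ _ ele]; first by rewrite divr_gt0.
  apply: (le_trans ele).
  have := gnorm_dist Gpos v0 w; rewrite ler_norml => /andP[_ H].
  move: vw; rewrite ltr_pdivlMr ?mulr_gt0 // => vw.
  have := HA (v0 - w); lra.
exists (m ^+ 2) => [|v]; first by rewrite exprn_gt0.
have [->|v0] := eqVneq v 0.
  by rewrite normr0 expr0n mulr0; apply: gram_form_ge0.
have nv : 0 < `|v| by rewrite normr_gt0.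
have /Hm : `|(`|v|^-1 *: v)| = 1.
  by rewrite normrZ normfV normr_id mulVf // gt_eqF.
rewrite gnormZ normfV normr_id ler_pdivlMl // => H.
rewrite -[leRHS]sqr_sqrtr ?gram_form_ge0 // -exprMn mulrC.
by rewrite lerXn2r ?nnegrE ?mulr_ge0 ?(ltW m0) // gnorm_ge0.
Qed.

(** One [A] serves all [p] near [p0]: changing the Gram matrix by less than [m / (2 * K)] moves the
    form by at most half of its lower bound at [p0]. *)
Lemma gnorm_equiv_near (F : 'rV[R]_d -> 'M[R]_d) p0 :
  {for p0, continuous F} -> posdef (F p0) ->
  exists e : R, exists2 A : R, 0 < e /\ 0 < A & forall p, `|p0 - p| < e ->
  forall v, `|v| <= A * gnorm (F p) v /\ gnorm (F p) v <= A * `|v|.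
Proof.
move=> Fcont Fpos; have [m m0 Hm] := norm_le_gnorm Fpos.
pose K : R := d%:R ^+ 2 + 1.
have K0 : 0 < K by rewrite ltr_wpDl // sqr_ge0.
have /Fcont : nbhs (F p0) [set H | `|F p0 - H| < m / (2 * K)].
  by apply: nbhs_dist_lt; rewrite divr_gt0 // mulr_gt0.
move=> /nbhs_normP[e /= e0 He].
pose A2 : R := Num.max (2 / m) (d%:R ^+ 2 * (`|F p0| + m / (2 * K))).
have A20 : 0 < A2 by rewrite lt_max divr_gt0.
exists e, (Num.sqrt A2) => [|p pe v]; first by rewrite sqrtr_gt0.
have {}He : `|F p0 - F p| < m / (2 * K) by exact: He.
have dif : `|gram_form (F p0) v v - gram_form (F p) v v| <= m / 2 * `|v| ^+ 2.
  have -> : gram_form (F p0) v v - gram_form (F p) v v = gram_form (F p0 - F p) v v.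
    by rewrite /gram_form mulmxBr mulmxBl [RHS]mxE; congr (_ + _); rewrite [RHS]mxE.
  apply: (le_trans (gram_form_le_norm _ _)); rewrite ler_wpM2r ?sqr_ge0 //.
  apply: (@le_trans _ _ (K * (m / (2 * K)))).
    by apply: ler_pM; rewrite ?sqr_ge0 ?lerDl // ltW.
  by rewrite le_eqVlt; apply/orP; left; apply/eqP; field; rewrite gt_eqF.
have lo : m / 2 * `|v| ^+ 2 <= gram_form (F p) v v.
  by have := Hm v; move: dif; rewrite ler_norml => /andP[_]; lra.
have gp0 : 0 <= gram_form (F p) v v.
  by apply: le_trans lo; rewrite mulr_ge0 ?sqr_ge0 // divr_ge0 // ltW.
split.
  rewrite -[leLHS]ger0_norm // -sqrtr_sqr /gnorm -sqrtrM ?(ltW A20) //.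
  rewrite ler_wsqrtr //; apply: (@le_trans _ _ (2 / m * gram_form (F p) v v)).
    have : 2 / m * (m / 2 * `|v| ^+ 2) <= 2 / m * gram_form (F p) v v.
      by rewrite ler_wpM2l // divr_ge0 // ltW.
    apply: le_trans; rewrite le_eqVlt; apply/orP; left; apply/eqP; field.
    by rewrite gt_eqF.
  by rewrite ler_wpM2r // le_max lexx.
rewrite -[`|v|]ger0_norm // -sqrtr_sqr /gnorm -sqrtrM ?(ltW A20) //.
rewrite ler_wsqrtr // (le_trans (ler_norm _)) // (le_trans (gram_form_le_norm _ _)) //.
rewrite ler_wpM2r ?sqr_ge0 // le_max; apply/orP; right; rewrite ler_wpM2l ?sqr_ge0 //.
have := ler_normB (F p0) (F p0 - F p); rewrite opprB addrC subrK; lra.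
Qed.

End Norms.

(** The one-variable mean value theorem is applied along the segment to each coordinate separately;
    the intermediate points may differ, which costs nothing in the sup norm. Later [l] is the image
    of [p - q] under the derivative at a third point. *)
Lemma mean_value_ineq (R : realType) (n d : nat) (F : 'rV[R]_n -> 'rV[R]_d)
    (p q : 'rV[R]_n) (l : 'rV[R]_d) (B : R) : 0 <= B ->
  (forall t : R, 0 <= t <= 1 -> differentiable F (q + t *: (p - q))) ->
  (forall t : R, 0 <= t <= 1 -> `|'d F (q + t *: (p - q)) (p - q) - l| <= B) ->
  `|F p - F q - l| <= B.
Proof.
move=> B0 Fdiff Fbd; apply: norm_le_coord => // i.
pose line (t : R) : 'rV[R]_n := q + t *: (p - q).
pose h (t : R) : R := F (line t) 0 i.
pose dh (t : R) : R := 'd F (line t) (p - q) 0 i.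
have hder (t : R) : 0 <= t <= 1 -> is_derive t (1 : R) h (dh t).
  move=> t01; have Fd := Fdiff t t01.
  have /= FD : (fun x : R => x^-1 *: ((F \o shift (line t)) (x *: (p - q)) - F (line t)))
      @ 0^' --> 'd F (line t) (p - q).
    by rewrite -(deriveE _ Fd); exact: (diff_derivable Fd).
  have hD : (fun x : R => x^-1 *: ((h \o shift t) (x *: (1 : R)) - h t))
      @ 0^' --> dh t.
    have := cvg_comp _ _ FD (@coord_continuous R 1 d 0 i _).
    apply: cvg_trans; apply: near_eq_cvg; near=> x => /=.
    rewrite !mxE; congr (_ * (_ - _)); congr (F _ 0 i); rewrite /line.
    rewrite (_ : _%:A = x); last exact: mulr1.
    by rewrite scalerDl addrCA.
  split; [exact: cvgP hD | exact: (cvg_lim _ hD)].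
have hcont : {within `[0, 1]%classic, continuous h}.
  apply: derivable_within_continuous => t; rewrite in_itv /= => t01.
  exact: (@ex_derive _ _ _ _ _ _ _ (hder t t01)).
have [|t] := @MVT_segment R h dh 0 1 ler01 _ hcont.
  by move=> t; rewrite in_itv /= => /andP[/ltW t0 /ltW t1]; apply: hder; rewrite t0.
rewrite in_itv /= subr0 mulr1 => t01 h10.
have -> : (F p - F q - l) 0 i = ('d F (q + t *: (p - q)) (p - q) - l) 0 i.
  by rewrite !mxE -/(dh t) -h10 /h /line scale1r scale0r addr0 (addrC q) subrK.
exact: le_trans (coord_le_norm _ _) (Fbd _ t01).
Unshelve. all: by end_near. Qed.

(** * Bounded distortion *)

(** Here [S] is the relative error of [q] with respect to [L * Q0], and [e] that of one more step.
    Since [(1 + e) * (1 + S) <= 1 + S + 2 * e] for [S <= 1], relative errors add up, each new one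
    counted at most twice. *)
Lemma distortion_step (R : realType) (L S e S' a q q' Q0 : R) :
  0 <= Q0 -> 0 <= L -> 0 <= S -> 0 <= e -> 1 <= a ->
  L * (1 - S) * Q0 <= q -> q <= L * (1 + S) * Q0 ->
  `|q' - a * q| <= e * (a * q) -> S + 2 * e <= S' -> S' <= 2^-1 -> 0 <= q ->
  L * a * (1 - S') * Q0 <= q' /\ q' <= L * a * (1 + S') * Q0.
Proof.
move=> Q00 L0 S0 e0 a1 ql qu; rewrite ler_distlC => /andP[q'l q'u] SS S1 q0.
have aLQ : 0 <= a * (L * Q0) by rewrite !mulr_ge0 //; lra.
have a0 : 0 <= a by lra.
have e1 : 0 <= 1 - e by lra.
have Se : 0 <= S * e by exact: mulr_ge0.
have Se1 : S * e <= 2^-1 * e by apply: ler_wpM2r => //; lra.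
split.
  have k1 : a * ((1 - e) * (L * (1 - S) * Q0)) <= a * ((1 - e) * q).
    by rewrite ler_wpM2l // ler_wpM2l.
  have k2 : a * (L * Q0) * (1 - S') <= a * (L * Q0) * ((1 - e) * (1 - S)).
    by apply: ler_wpM2l => //; lra.
  lra.
have k1 : a * ((1 + e) * q) <= a * ((1 + e) * (L * (1 + S) * Q0)).
  by apply: ler_wpM2l => //; apply: ler_wpM2l => //; lra.
have k2 : a * (L * Q0) * ((1 + e) * (1 + S)) <= a * (L * Q0) * (1 + S').
  by apply: ler_wpM2l => //; lra.
lra.
Qed.

(* [Q x a b] is the length of the difference of [a] and [b] read in a chart
   chosen at [x], whose domain is [dm x]; [al x] is the conformal factor of the
   map at [x]. *)
Section Distortion.
Variables (R : realType) (M : Type) (f : M -> M).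
Variables (Q : M -> M -> M -> R) (dm : M -> M -> Prop) (al : M -> R).
Variables (s1 s2 theta C r1 : R).
Hypothesis s1_gt1 : 1 < s1.
Hypothesis al_bound : forall x, s1 <= al x <= s2.

Definition Lam (k : nat) (x : M) : R := \prod_(i < k) al (iter i f x).

Lemma LamS k x : Lam k.+1 x = Lam k x * al (iter k f x).
Proof. by rewrite /Lam big_ord_recr. Qed.

Lemma Lam_gt0 k x : 0 < Lam k x.
Proof.
elim: k => [|k IH]; first by rewrite /Lam big_ord0.
by rewrite LamS mulr_gt0 //; have /andP[H _] := al_bound (iter k f x); have h1 := s1_gt1; lra.
Qed.

Lemma Lam_growth i m x : Lam i x * s1 ^+ m <= Lam (i + m) x.
Proof.
elim: m => [|m IH]; first by rewrite addn0 mulr1.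
rewrite addnS LamS exprSr mulrA.
have /andP[H _] := al_bound (iter (i + m) f x).
have h1 := s1_gt1; have L0 := Lam_gt0 i x.
have s0 : 0 < s1 ^+ m by rewrite exprn_gt0 //; lra.
by apply: ler_pM => //; [rewrite mulr_ge0 ?ltW | lra].
Qed.

Lemma Lam_ge_expr k x : s1 ^+ k <= Lam k x.
Proof. by have := Lam_growth 0 k x; rewrite {1}/Lam big_ord0 mul1r. Qed.

Hypothesis theta_gt0 : 0 < theta.
Hypothesis C_ge0 : 0 <= C.
Hypothesis r1_gt0 : 0 < r1.
Hypothesis dm_refl : forall x, dm x x.
Hypothesis Q_ge0 : forall x a b, 0 <= Q x a b.
Hypothesis Q_refl : forall x, Q x x x = 0.
Hypothesis step : forall x a b s, s <= r1 -> dm x a -> dm x b ->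
  Q x a x <= s -> Q x b x <= s ->
  [/\ dm (f x) (f a), dm (f x) (f b) &
      `|Q (f x) (f a) (f b) - al x * Q x a b| <= C * s `^ theta * Q x a b].

(** The relative errors are dominated by a geometric series of ratio [t], the largest at the end. In
    the conclusion, the bound on the image keeps it at scale [delta], and the last inequality turns
    closeness at time [k] into closeness in the initial ball. *)
Lemma bounded_distortion : exists2 delta : R, 0 < delta &
  forall x k (rho : R), 0 <= rho -> Lam k x * rho <= delta ->
  forall a b, dm x a -> dm x b -> Q x a x <= rho -> Q x b x <= rho ->
  [/\ dm (iter k f x) (iter k f a),
      Q (iter k f x) (iter k f a) (iter k f x) <= 2 * (Lam k x * rho) &
      Lam k x * Q x a b <= 2 * Q (iter k f x) (iter k f a) (iter k f b)].
Proof.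
have [[[h1 hth] hC] hr1] := (s1_gt1, theta_gt0, C_ge0, r1_gt0).
set t := (s1 `^ theta)^-1.
have st1 : 1 < s1 `^ theta.
  have := gt0_ltr_powR hth _ _ h1; rewrite powR1 !nnegrE.
  by apply; lra.
have t0 : 0 < t by rewrite invr_gt0; lra.
have t1 : t < 1 by rewrite invf_lt1 //; lra.
(* This makes [A * t + 2 * t <= A], which after multiplication by [kap * t ^+ (k - i.+1)] is the
   induction step [S i + 2 * e <= S i.+1]. *)
set A := 2 / (1 - t).
have A0 : 0 < A by apply: divr_gt0; lra.
have At : A * t + 2 * t <= A.
  suff : A * (1 - t) = 2 by lra.
  by rewrite /A divfK //; apply/eqP; lra.
(* With this [u], the bound [2 * delta <= u] forces [kap * A <= 2^-1], which caps the accumulated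
   error; [C + 1] avoids a division by zero. *)
set u := ((2 * A * (C + 1))^-1) `^ (theta^-1).
have AC0 : 0 < 2 * A * (C + 1) by apply: mulr_gt0; lra.
have u0 : 0 < u by rewrite powR_gt0 // invr_gt0.
pose delta : R := Num.min (r1 / 2) (u / 2).
have delta0 : 0 < delta by rewrite lt_min; apply/andP; split; rewrite divr_gt0.
have d1 : delta <= r1 / 2 by rewrite ge_min lexx.
have d2 : delta <= u / 2 by rewrite ge_min lexx orbT.
have dr1 : 2 * delta <= r1 by lra.
have du : 2 * delta <= u by lra.
set kap := C * (2 * delta) `^ theta.
have kap0 : 0 <= kap by rewrite mulr_ge0 // powR_ge0.
have kapA : kap * A <= 2^-1.
  have : (2 * delta) `^ theta <= (2 * A * (C + 1))^-1.
    have -> : (2 * A * (C + 1))^-1 = u `^ theta.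
      by rewrite /u -powRrM mulVf ?gt_eqF // powRr1 // invr_ge0 ltW.
    by apply: ge0_ler_powR; rewrite ?nnegrE; lra.
  move=> H; apply: (@le_trans _ _ (C * (2 * A * (C + 1))^-1 * A)).
    by rewrite ler_wpM2r ?(ltW A0) // ler_wpM2l.
  have -> : C * (2 * A * (C + 1))^-1 * A = C / (C + 1) * 2^-1.
    by field; rewrite !gt_eqF //; lra.
  rewrite -[leRHS]mul1r ler_wpM2r // ler_pdivrMr; lra.
exists delta => // x k rho rho0 Lrho.
(* [S i] bounds the accumulated relative error up to time [i]; the error made
   at time [i] is at most [kap * t ^+ (k - i)]. *)
pose S i := kap * A * t ^+ (k - i).
have S01 i : 0 <= S i <= 2^-1.
  have p0 : 0 <= t ^+ (k - i) by apply: exprn_ge0; exact: ltW.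
  have p1 : t ^+ (k - i) <= 1 by apply: exprn_ile1; exact: ltW.
  have KA : 0 <= kap * A by apply: mulr_ge0 => //; exact: ltW.
  rewrite /S mulr_ge0 //=; apply: le_trans kapA; exact: ler_piMr.
have Lrho_bd i : (i <= k)%N ->
    0 <= 2 * (Lam i x * rho) <= 2 * delta / s1 ^+ (k - i).
  move=> ik; rewrite !mulr_ge0 ?(ltW (Lam_gt0 _ _)) //=.
  have s0 : 0 < s1 ^+ (k - i) by rewrite exprn_gt0 //; lra.
  rewrite -mulrA ler_wpM2l // ler_pdivlMr //.
  apply: le_trans Lrho; rewrite mulrAC ler_wpM2r //.
  by have := Lam_growth i (k - i) x; rewrite subnKC.
have err i : (i <= k)%N ->
    C * (2 * (Lam i x * rho)) `^ theta <= kap * t ^+ (k - i).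
  move=> ik; rewrite /kap -mulrA ler_wpM2l //.
  have /andP[L0 L1] := Lrho_bd _ ik.
  have s0 : 0 < s1 ^+ (k - i) by rewrite exprn_gt0 //; lra.
  apply: (@le_trans _ _ ((2 * delta / s1 ^+ (k - i)) `^ theta)).
    by apply: ge0_ler_powR; rewrite ?nnegrE //; lra.
  rewrite powRM ?invr_ge0 ?(ltW s0) //; last by lra.
  rewrite ler_wpM2l ?powR_ge0 // le_eqVlt; apply/orP; left; apply/eqP.
  elim: (k - i)%N => [|n IHn]; first by rewrite invr1 powR1.
  rewrite !exprS invfM powRM ?invr_ge0 ?exprn_ge0 //; [|lra|lra].
  rewrite IHn /t; congr (_ * _).
  by rewrite -powR_inv1 ?powRrM 1?mulrC -?powRrM ?[_ * -1]mulrC ?powRrM ?powR_inv1 //; lra.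
have main i : (i <= k)%N -> forall a b, dm x a -> dm x b ->
    Q x a x <= rho -> Q x b x <= rho ->
    [/\ dm (iter i f x) (iter i f a), dm (iter i f x) (iter i f b),
      Lam i x * (1 - S i) * Q x a b <= Q (iter i f x) (iter i f a) (iter i f b) &
      Q (iter i f x) (iter i f a) (iter i f b) <= Lam i x * (1 + S i) * Q x a b].
  elim: i => [|i IH] ik a b da db Qa Qb.
    have /andP[S0 _] := S01 0%N; have Q0 := Q_ge0 x a b.
    by rewrite /Lam big_ord0; split => //=; nra.
  have {}IH := IH (ltnW ik).
  have Qx : Q x x x <= rho by rewrite Q_refl.
  have dx := dm_refl x.
  have /andP[S0 S1] := S01 i.
  have L0 := Lam_gt0 i x.
  have up c (Qc : Q x c x <= rho) :
      Lam i x * (1 + S i) * Q x c x <= 2 * (Lam i x * rho).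
    have Q0 := Q_ge0 x c x.
    have : (1 + S i) * Q x c x <= 2 * rho by nra.
    by nra.
  (* The pairs with [x] keep both orbits within reach of [step]; the pair [a], [b] carries the
     estimate itself. *)
  have [dai _ _ Qai] := IH a x da dx Qa Qx.
  have [dbi _ _ Qbi] := IH b x db dx Qb Qx.
  have [_ _ Ql Qu] := IH a b da db Qa Qb.
  have sr1 : 2 * (Lam i x * rho) <= r1.
    have /andP[_] := Lrho_bd _ (ltnW ik); move/le_trans; apply.
    have s0 : 1 <= s1 ^+ (k - i) by apply: exprn_ege1; exact: ltW.
    apply: le_trans dr1; rewrite ler_pdivrMr; last exact: lt_le_trans s0.
    by apply: ler_peMr => //; lra.
  have [dfa dfb] := step sr1 dai dbi (le_trans Qai (up _ Qa))
    (le_trans Qbi (up _ Qb)).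
  have e_le := err _ (ltnW ik).
  have Qi0 := Q_ge0 (iter i f x) (iter i f a) (iter i f b).
  set q := Q (iter i f x) (iter i f a) (iter i f b) in Ql Qu Qi0 *.
  set e := kap * t ^+ (k - i) in e_le.
  have e0 : 0 <= e by rewrite mulr_ge0 // exprn_ge0 // ltW.
  have al1 : 1 <= al (iter i f x).
    by have /andP[H _] := al_bound (iter i f x); apply: le_trans H; exact: ltW.
  move=> dist.
  have {}dist : `|Q (f (iter i f x)) (f (iter i f a)) (f (iter i f b)) -
      al (iter i f x) * q| <= e * (al (iter i f x) * q).
    apply: (le_trans dist); apply: (@le_trans _ _ (e * q)).
      by rewrite ler_wpM2r.
    by rewrite ler_wpM2l // ler_peMl.
  have SS : S i + 2 * e <= S i.+1.
    rewrite /S /e -subnSK // exprS.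
    have p0 : 0 <= kap * t ^+ (k - i.+1) by rewrite mulr_ge0 // exprn_ge0 // ltW.
    have := ler_wpM2l p0 At; lra.
  have /andP[_ S1'] := S01 i.+1.
  have Q00 := Q_ge0 x a b.
  rewrite LamS; split=> //.
    exact: (distortion_step Q00 (ltW L0) S0 e0 al1 Ql Qu dist SS S1' Qi0).1.
  exact: (distortion_step Q00 (ltW L0) S0 e0 al1 Ql Qu dist SS S1' Qi0).2.
move=> a b da db Qa Qb.
have Qx : Q x x x <= rho by rewrite Q_refl.
have [dak _ _ Qak] := main k (leqnn k) a x da (dm_refl x) Qa Qx.
have [_ _ Ql _] := main k (leqnn k) a b da db Qa Qb.
have /andP[S0 S1] := S01 k; have L0 := Lam_gt0 k x.
split => //.
  apply: (le_trans Qak); have Q0 := Q_ge0 x a x.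
  have : (1 + S k) * Q x a x <= 2 * rho by nra.
  by nra.
have LQ : 0 <= Lam k x * Q x a b by rewrite mulr_ge0 // ltW.
by nra.
Qed.

End Distortion.

(** * The game *)

Section Enorm.
Variables (R : realType) (d : nat).
Implicit Types v w : 'rV[R]_d.

Lemma enorm_ge0 v : 0 <= enorm v.
Proof. exact: sqrtr_ge0. Qed.

Lemma enorm_triangle v w : enorm (v + w) <= enorm v + enorm w.
Proof. by rewrite !enormE; apply: gnorm_triangle; exact: posdef1. Qed.

Lemma enormZ a v : enorm (a *: v) = `|a| * enorm v.
Proof. by rewrite !enormE gnormZ. Qed.

Lemma enormBC v w : enorm (v - w) = enorm (w - v).
Proof. by rewrite -opprB !enormE gnormN. Qed.

Lemma enorm0 : enorm (0 : 'rV[R]_d) = 0.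
Proof. by rewrite -(scale0r (0 : 'rV[R]_d)) enormZ normr0 mul0r. Qed.

Lemma cball_center (b : 'rV[R]_d * R) : 0 <= b.2 -> cball b b.1.
Proof. by rewrite /cball /= subrr enorm0. Qed.

Lemma cball_dist (b : 'rV[R]_d * R) v w : cball b v -> cball b w ->
  enorm (v - w) <= 2 * b.2.
Proof.
rewrite /cball /= => bv bw.
have := enorm_triangle (v - b.1) (b.1 - w).
by rewrite addrA subrK (enormBC b.1); lra.
Qed.

Lemma cball_closed (b : 'rV[R]_d * R) : closed (cball b).
Proof.
move=> z zcl; rewrite /cball /= leNgt; apply/negP => lt_z.
have [|w [bw zw]] := zcl [set w | `|z - w| < (enorm (z - b.1) - b.2) / d.+1%:R].
  by apply: nbhs_dist_lt; rewrite divr_gt0 // subr_gt0.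
have := enorm_triangle (z - w) (w - b.1); rewrite addrA subrK.
have := enorm_le_norm (z - w); move: bw zw; rewrite /cball /=.
rewrite ltr_pdivlMr // mulrC; lra.
Qed.

Lemma cball_compact (b : 'rV[R]_d * R) : compact (cball b).
Proof.
apply: bounded_closed_compact; last exact: cball_closed.
exists (`|b.1| + b.2); split=> [|M HM z bz]; first exact: num_real.
have := norm_le_enorm (z - b.1); move: bz; rewrite /cball /= => bz.
have := ler_normD (z - b.1) b.1; rewrite subrK; lra.
Qed.

Lemma nested_cball (B : nat -> 'rV[R]_d * R) :
  (forall n, 0 <= (B n).2) -> (forall n, cball (B n.+1) `<=` cball (B n)) ->
  exists z, forall n, cball (B n) z.
Proof.
move=> B0 Bn.
have nest m n : (m <= n)%N -> cball (B n) `<=` cball (B m).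
  move/subnK <-; elim: (n - m)%N => [//|k IH].
  by rewrite addSn; apply: subset_trans IH; exact: Bn.
(* The centres cluster in the compact first ball, and a cluster point lies in every ball because the
   balls are nested and closed. *)
have /(_ ((fun n => (B n).1) @ \oo) _)[|z [_ zcl]] := @cball_compact (B 0%N).
  by exists 0%N => // n /= n0; apply: nest n0 _ _; exact: cball_center.
exists z => n; apply: (@cball_closed (B n)) => U Uz.
have [|w [? ?]] := zcl (cball (B n)) U _ Uz; last by exists w.
by exists n => // m /= nm; apply: nest nm _ _; exact: cball_center.
Qed.

(* The ray from [z0] through the centre of the smaller ball crosses that ball
   in a segment lying at distance between [e] and twice the larger radius from
   [z0]. *)
Lemma cball_shrink (b b' : 'rV[R]_d * R) z0 e : 0 < e -> 0 <= b'.2 ->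
  cball b z0 -> cball b' `<=` cball b `\` point_nbhd (z0, e) ->
  2 * b'.2 + e <= 2 * b.2.
Proof.
move=> e0 r0 bz0 sub.
set l := enorm (b'.1 - z0).
have lP : e <= l.
  have [_] := sub _ (cball_center r0).
  by rewrite /point_nbhd /= -/l => /negP; rewrite -leNgt.
have l0 : 0 < l by lra.
have ray t : cball b' (z0 + t *: (b'.1 - z0)) <-> `|t - 1| * l <= b'.2.
  rewrite /cball /= -/l -enormZ.
  have -> // : z0 + t *: (b'.1 - z0) - b'.1 = (t - 1) *: (b'.1 - z0).
  by rewrite scalerBl scale1r opprB addrAC [RHS]addrC.
have rayD t : enorm (z0 + t *: (b'.1 - z0) - z0) = `|t| * l.
  by rewrite addrAC subrr add0r enormZ.
have far : l + b'.2 <= 2 * b.2.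
  have t0 : 0 <= b'.2 / l by rewrite divr_ge0 // ltW.
  have /sub[H _] : cball b' (z0 + (1 + b'.2 / l) *: (b'.1 - z0)).
    by apply/ray; rewrite addrAC subrr add0r ger0_norm // divfK // gt_eqF.
  have := cball_dist H bz0; rewrite rayD ger0_norm; last by lra.
  by rewrite mulrDl mul1r divfK // gt_eqF.
suff near_pt : e + b'.2 <= l by lra.
have [lr|rl] := leP l b'.2.
  have /sub[_] : cball b' (z0 + 0 *: (b'.1 - z0)).
    by apply/ray; rewrite sub0r normrN normr1 mul1r.
  by rewrite /point_nbhd /= rayD normr0 mul0r => /(_ e0).
have t0 : 0 <= b'.2 / l by rewrite divr_ge0 // ltW.
have t1 : b'.2 / l <= 1 by rewrite ler_pdivrMr // mul1r ltW.
have /sub[_] : cball b' (z0 + (1 - b'.2 / l) *: (b'.1 - z0)).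
  apply/ray; rewrite addrAC subrr add0r normrN ger0_norm // divfK // gt_eqF //.
rewrite /point_nbhd /= rayD ger0_norm; last by lra.
rewrite mulrBl mul1r divfK ?gt_eqF // => /negP; rewrite -leNgt; lra.
Qed.

End Enorm.

(** * Separation of finitely many points at a common scale *)

Section Separation.
Variables (R : realType) (M : topologicalType).
Variables (Q : M -> M -> M -> R) (dm : M -> M -> Prop).

(* At scale [delta] the points [p] and [p'] look either far apart (no [x] sees
   both) or equal. *)
Definition separated (p p' : M) (delta : R) := forall r, 0 < r ->
  exists W W' : set M, [/\ nbhs p W, nbhs p' W' & forall x w w', W w -> W' w' ->
    dm x w -> dm x w' -> Q x w x <= delta -> Q x w' x <= delta -> Q x w w' < r].

Hypothesis sepP : forall p p', \forall delta \near 0^'+, separated p p' delta.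

Lemma separated_family n (p : 'I_n -> M) : exists2 delta : R, 0 < delta &
  forall r, 0 < r -> exists W : 'I_n -> set M, (forall i, nbhs (p i) (W i)) /\
    forall x i i' w w', W i w -> W i' w' -> dm x w -> dm x w' ->
      Q x w x <= delta -> Q x w' x <= delta -> Q x w w' < r.
Proof.
have [delta [d0 sep]] : exists delta : R, 0 < delta /\
    forall i i', separated (p i) (p i') delta.
  near (0:R)^'+ => delta; exists delta; split=> //.
  by near: delta; apply: filter_forall => i; apply: filter_forall => i'.
exists delta => // r r0.
have /choice[W1 HW1] (ii : 'I_n * 'I_n) : exists W1 : set M * set M,
    [/\ nbhs (p ii.1) W1.1, nbhs (p ii.2) W1.2 & forall x w w',
     W1.1 w -> W1.2 w' -> dm x w -> dm x w' ->
     Q x w x <= delta -> Q x w' x <= delta -> Q x w w' < r].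
  by have [W [W' H]] := sep ii.1 ii.2 _ r0; exists (W, W').
(* The neighbourhood [W i] has to serve in both roles against every index [i'], including [i]
   itself. *)
exists (fun i => [set m | forall i', (W1 (i, i')).1 m /\ (W1 (i', i)).2 m]); split.
  move=> i; apply: filter_forall => i'; apply: filterI.
    by have [] := HW1 (i, i').
  by have [] := HW1 (i', i).
move=> x i i' w w' /(_ i')[W1w _] /(_ i)[_ W2w'].
by have [_ _] := HW1 (i, i'); exact.
Unshelve. all: by end_near. Qed.

End Separation.

(** * Alice's strategy for a given first ball of Bob *)

Section Game.
Variables (R : realType) (d : nat) (M : topologicalType) (f : M -> M) (y : M).
Variables (Q : M -> M -> M -> R) (dm : M -> M -> Prop) (al : M -> R).
Variables (s1 s2 beta A : R) (b0 : 'rV[R]_d * R) (phi : 'rV[R]_d -> M).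
Hypothesis f_cont : continuous f.
Hypothesis s1_gt1 : 1 < s1.
Hypothesis al_bound : forall x, s1 <= al x <= s2.
Hypothesis A_gt0 : 0 < A.
Hypothesis b0_gt0 : 0 < b0.2.
Hypothesis beta_gt0 : 0 < beta.
Hypothesis phi_dm : forall z a, cball b0 z -> cball b0 a -> dm (phi z) (phi a).
Hypothesis phi_bilip : forall z a b, cball b0 z -> cball b0 a -> cball b0 b ->
  enorm (a - b) <= A * Q (phi z) (phi a) (phi b) /\
  Q (phi z) (phi a) (phi b) <= A * enorm (a - b).
Hypothesis distortion : exists2 delta : R, 0 < delta &
  forall x k (rho : R), 0 <= rho -> Lam f al k x * rho <= delta ->
  forall a b, dm x a -> dm x b -> Q x a x <= rho -> Q x b x <= rho ->
  [/\ dm (iter k f x) (iter k f a),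
      Q (iter k f x) (iter k f a) (iter k f x) <= 2 * (Lam f al k x * rho) &
      Lam f al k x * Q x a b <= 2 * Q (iter k f x) (iter k f a) (iter k f b)].
Hypothesis sepP :
  forall p p', \forall delta \near 0^'+, separated Q dm p p' delta.

Let Lam := Lam f al.

Lemma iter_continuous n : continuous (iter n f).
Proof.
elim: n => [|n IH] x; first exact: cvg_id.
by apply: continuous_comp; [exact: IH|exact: f_cont].
Qed.

(* The time window [N] is fixed first, and only then the scale [delta], at
   which the first [N] images of [y] are separated; [W] is chosen last. *)
Lemma game_constants : exists (N : nat) (delta r : R) (W : 'I_N.+1 -> set M),
  [/\ 0 < delta, 1 <= beta * s1 ^+ N, delta < s1 ^+ N * (2 * A * b0.2),
      2 * A * r = beta * delta / (2 * A * s2) &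
  [/\ forall i : 'I_N.+1, nbhs (iter i f y) (W i),
     forall x i i' w w', W i w -> W i' w' -> dm x w -> dm x w' ->
      Q x w x <= 2 * delta -> Q x w' x <= 2 * delta -> Q x w w' < r &
     forall x k (rho : R), 0 <= rho -> Lam k x * rho <= delta ->
     forall a b, dm x a -> dm x b -> Q x a x <= rho -> Q x b x <= rho ->
     [/\ dm (iter k f x) (iter k f a),
      Q (iter k f x) (iter k f a) (iter k f x) <= 2 * (Lam k x * rho) &
      Lam k x * Q x a b <= 2 * Q (iter k f x) (iter k f a) (iter k f b)]]].
Proof.
have [[[h1 hA] hb] hbeta] := (s1_gt1, A_gt0, b0_gt0, beta_gt0).
have s1s2 : s1 <= s2 by have /andP[H1 H2] := al_bound y; exact: le_trans H1 H2.
have sc0 : 0 < 2 * A * b0.2 by rewrite !mulr_gt0.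
have [N1 HN1] := expr_unbounded beta^-1 h1.
have [N2 HN2] := expr_unbounded (2 * A * b0.2)^-1 h1.
pose N := (N1 + N2)%N.
have N1N : s1 ^+ N1 <= s1 ^+ N by rewrite ler_weXn2l ?leq_addr // ltW.
have N2N : s1 ^+ N2 <= s1 ^+ N by rewrite ler_weXn2l ?leq_addl // ltW.
have [delta2 delta2_gt0 sep] := separated_family sepP (fun i : 'I_N.+1 => iter i f y).
have [delta1 delta1_gt0 dist] := distortion.
(* By the choice of [N2], already [1] is below [s1 ^+ N * (2 * A * b0.2)]. Half of [delta2] is taken
   because images of balls may have size [2 * delta]. *)
pose delta : R := Num.min 1 (Num.min delta1 (delta2 / 2)).
have delta0 : 0 < delta by rewrite !lt_min ltr01 delta1_gt0 divr_gt0.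
have le1 : delta <= 1 by rewrite ge_min lexx.
have led1 : delta <= delta1 by rewrite !ge_min lexx orbT.
have led2 : 2 * delta <= delta2.
  have : delta <= delta2 / 2 by rewrite !ge_min lexx !orbT.
  lra.
have s20 : 0 < s2 by lra.
pose r := beta * delta / (2 * A * s2) / (2 * A).
have r0 : 0 < r by rewrite !divr_gt0 // ?mulr_gt0 // mulr_gt0.
have [W [Wy Wsep]] := sep _ r0.
exists N, delta, r, W; split => //.
- by rewrite mulrC -ler_pdivrMr // mul1r; apply/ltW/(lt_le_trans HN1).
- apply: (le_lt_trans le1); rewrite -ltr_pdivrMr // mul1r.
  exact: lt_le_trans N2N.
- by rewrite /r; field; rewrite !gt_eqF.
split => // [x i i' w w' Ww Ww' dw dw' Qw Qw'|x k rho rho0 /le_trans H].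
  by apply: Wsep Ww Ww' _ _ _ _ => //; lra.
by apply: dist => //; exact: H.
Qed.

(** Suppose the orbit of the limit point comes close to [y] at time [j]. In the first ball that
    admits a time at least [j], the best time [k] lies between [j] and [j + N], so the point is
    threatened there and gets removed. *)
Lemma game_won : exists2 sigma : strategy R d, legal_strategy beta sigma &
  forall U B, B 0%N = b0 -> legal_play beta U sigma B ->
  exists2 z, (forall n, cball (B n) z) & orbit_avoiding f y (phi z).
Proof.
have [N [delta [r [W [delta0 HN HN0 Hr [Wy Wsep dist]]]]]] := game_constants.
have [[[h1 hA] hb] hbeta] := (s1_gt1, A_gt0, b0_gt0, beta_gt0).
have s1s2 : s1 <= s2 by have /andP[H1 H2] := al_bound y; exact: le_trans H1 H2.
have s20 : 0 < s2 by lra.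
have LamP k x : 0 < Lam k x by exact: (Lam_gt0 f s1_gt1 al_bound k x).
(* Measured by [Q] from any of its points, a ball [b] inside [b0] has diameter at most [sc b]. *)
pose sc (b : 'rV[R]_d * R) := 2 * A * b.2.
(* Admissible times: the distortion bound applies to all of [b] up to time [k], seen from some point
   of [b]. *)
pose G b k := exists2 z, cball b z & Lam k (phi z) * sc b <= delta.
pose best b k := G b k /\ forall k', G b k' -> (k' <= k)%N.
(* The points of [b] threatened at one of the last [N] times; by [T_small] below
   a single removed ball covers them. *)
pose T b := [set z | cball b z /\
  exists k, best b k /\ exists i, W i (iter k f (phi z))].
(* The default [b.1], used when no point is threatened, still lies in the ball; hence Bob's radius
   has to shrink in any case. *)
pose sigma : strategy R d := fun s => let b := last b0 s in
  (xget b.1 (T b), beta * b.2).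
(* At time [k] the images of two threatened points are less than [r] apart, while by [Lbig] the
   expansion up to [k] is almost as large as it can be; undoing it leaves less than [beta * b.2]. *)
have T_small b z z' : 0 < b.2 -> cball b `<=` cball b0 -> T b z -> T b z' ->
    enorm (z - z') < beta * b.2.
  move=> bgt0 bb0 [bz [k [[[zs bzs Gk] maxk] [i Wi]]]].
  move=> [bz' [k' [[Gk' maxk'] [i' Wi']]]].
  have kk' : k' = k.
    by apply/eqP; rewrite eqn_leq maxk //= maxk' //; exists zs.
  rewrite {}kk' {k' Gk' maxk'} in Wi'.
  have scb : 0 < sc b by rewrite !mulr_gt0.
  have close a : cball b a -> dm (phi zs) (phi a) /\
      Q (phi zs) (phi a) (phi zs) <= sc b.
    move=> ba; split; first by apply: phi_dm; exact: bb0.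
    have [_ /le_trans] := phi_bilip (bb0 _ bzs) (bb0 _ ba) (bb0 _ bzs); apply.
    rewrite /sc mulrAC [leRHS]mulrC ler_pM2l //; exact: cball_dist.
  have [[dz Qz] [dz' Qz']] := (close _ bz, close _ bz').
  have [dkz Qkz Qk] := dist _ _ _ (ltW scb) Gk _ _ dz dz' Qz Qz'.
  have [dkz' Qkz' _] := dist _ _ _ (ltW scb) Gk _ _ dz' dz Qz' Qz.
  have Qr := Wsep _ _ _ _ _ Wi Wi' dkz dkz' (le_trans Qkz _) (le_trans Qkz' _).
  have {}Qr := Qr ltac:(lra) ltac:(lra).
  have [bil _] := phi_bilip (bb0 _ bzs) (bb0 _ bz) (bb0 _ bz').
  (* Time [k.+1] is not admissible from [zs], and one step expands by at most [s2]. *)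
  have Lbig : delta < Lam k (phi zs) * s2 * sc b.
    rewrite ltNge; apply/negP => H.
    suff /maxk : G b k.+1 by rewrite ltnn.
    exists zs => //; apply: le_trans H; rewrite /Lam LamS ler_pM2r //.
    by rewrite ler_pM2l; [have /andP[] := al_bound (iter k f (phi zs))|exact: LamP].
  rewrite -(ltr_pM2l (LamP k (phi zs))).
  apply: (@lt_trans _ _ (2 * A * r)).
    apply: (@le_lt_trans _ _ (A * (Lam k (phi zs) * Q (phi zs) (phi z) (phi z')))).
      by rewrite mulrCA ler_pM2l.
    by rewrite (mulrC 2) -mulrA ltr_pM2l //; lra.
  rewrite Hr ltr_pdivrMr ?mulr_gt0 //.
  have -> : Lam k (phi zs) * (beta * b.2) * (2 * A * s2) =
    beta * (Lam k (phi zs) * s2 * sc b) by rewrite /sc; ring.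
  by rewrite ltr_pM2l.
exists sigma => [s b bgt0|U B B0 [_ _ play]].
  by rewrite /sigma /= last_rcons mulr_gt0 // lexx.
have lastB n : last b0 (mkseq B n.+1) = B n.
  by rewrite (last_nth b0) size_mkseq /= -/(mkseq B n.+1) nth_mkseq.
have {}play n : beta * (B n).2 <= (B n.+1).2 /\ cball (B n.+1) `<=`
    cball (B n) `\` point_nbhd (xget (B n).1 (T (B n)), beta * (B n).2).
  by have := play n; rewrite /sigma lastB.
have Bpos n : 0 < (B n).2.
  elim: n => [|n IH]; first by rewrite B0.
  by apply: lt_le_trans (play n).1; rewrite mulr_gt0.
have nest n : cball (B n.+1) `<=` cball (B n).
  by move=> z /(play n).2 [].
have Bsub n : cball (B n) `<=` cball b0.
  by elim: n => [|n IH]; [rewrite B0 | apply: subset_trans IH].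
have Tball n : cball (B n) (xget (B n).1 (T (B n))).
  by case: xgetP => [z _ []|_] //; apply/cball_center/ltW.
(* The rules bound Bob's radii only from below. They tend to zero because the removed ball is
   centred in [B n], so that every time [j] is eventually admissible. *)
have Bshrink n : 2 * (B n.+1).2 + beta * (B n).2 <= 2 * (B n).2.
  apply: (cball_shrink _ _ (Tball n) (play n).2); last exact: ltW.
  by rewrite mulr_gt0.
(* The positive radius of the second ball forces this bound. *)
have beta2 : beta < 2.
  by rewrite -(ltr_pM2r (Bpos 0%N)); have := Bshrink 0%N; have := Bpos 1%N; lra.
have Bgeom n : (B n).2 <= (1 - beta / 2) ^+ n * b0.2.
  elim: n => [|n IH]; first by rewrite B0 mul1r.
  apply: (@le_trans _ _ ((1 - beta / 2) * (B n).2)).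
    by have := Bshrink n; lra.
  by rewrite exprS -mulrA ler_wpM2l //; lra.
have Bsmall e : 0 < e -> exists n, (B n).2 < e.
  move=> e0; have [|n Hn] := @expr_unbounded _ (1 - beta / 2)^-1 (b0.2 / e).
    by rewrite invf_gt1; lra.
  have q0 : 0 < (1 - beta / 2) ^+ n by rewrite exprn_gt0 //; lra.
  exists n; apply: le_lt_trans (Bgeom n) _.
  by move: Hn; rewrite exprVn ltr_pdivrMr // mulrC ltr_pdivlMr // mulrC.
have [z zB] := nested_cball (fun n => ltW (Bpos n)) nest.
exists z => // ycl.
(* An orbit that enters this neighbourhood of [y] at time [j] is in [W i] at time [j + i] for every
   [i <= N]. *)
have [] := ycl [set m | forall i : 'I_N.+1, W i (iter i f m)].
  by apply: filter_forall => i; apply: iter_continuous; exact: Wy.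
move=> _ [[j _ <-] /= Vj].
have Gbound n k : G (B n) k -> s1 ^+ k * sc (B n) <= delta.
  move=> [z' _]; apply: le_trans.
  rewrite ler_wpM2r ?mulr_ge0 ?(ltW (Bpos n)) ?(ltW hA) //.
  exact: (Lam_ge_expr f s1_gt1 al_bound k (phi z')).
(* The turn to look at is the first one whose ball admits a time at least [j]. *)
have exn : exists n, `[< exists2 k, (j <= k)%N & G (B n) k >].
  have e0 : 0 < delta / (Lam j (phi z) * (2 * A)) by rewrite divr_gt0 // !mulr_gt0.
  have [n Bn] := Bsmall _ e0; exists n; apply/asboolP; exists j => //; exists z => //.
  by move: Bn; rewrite ltr_pdivlMr ?mulr_gt0 // /sc => /ltW; lra.
case: (ex_minnP exn) => n /asboolP[k0 jk0 Gk0] minn {exn}.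
have [K HK] := @expr_unbounded _ s1 (delta / sc (B n)) h1.
have scn : 0 < sc (B n) by rewrite !mulr_gt0.
have Kub k : `[< G (B n) k >] -> (k <= K)%N.
  move=> /asboolP/Gbound; rewrite -ler_pdivlMr // => /le_lt_trans/(_ HK).
  by rewrite ltr_eXn2l // => /ltnW.
have exk : exists k, `[< G (B n) k >] by exists k0; exact/asboolP.
case: (ex_maxnP exk Kub) => k /asboolP Gk maxk.
have jk : (j <= k)%N by apply: (leq_trans jk0); apply: maxk; exact/asboolP.
have bestk : best (B n) k by split => // k' Gk'; apply: maxk; exact/asboolP.
(* For the first ball, [HN0] puts every admissible time below [N]. For a later ball, [k > j + N]
   would make [j] admissible for the preceding one, whose radius is at most [beta^-1] times larger,
   against the minimality of [n]. *)
have kjN : (k - j < N.+1)%N.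
  rewrite ltnS leqNgt; apply/negP => Nkj.
  case: n {Gk0 HK maxk exk Kub bestk} minn scn Gk => [|n] minn scn Gk.
    have := Gbound _ _ Gk; rewrite leNgt => /negP; apply.
    apply: (lt_le_trans HN0); rewrite /sc B0 ler_wpM2r ?mulr_ge0 ?(ltW hA) ?(ltW hb) //.
    rewrite ler_weXn2l ?ltW //; exact: leq_trans (ltnW Nkj) (leq_subr _ _).
  suff /asboolP/minn : exists2 k, (j <= k)%N & G (B n) k by rewrite ltnn.
  exists j => //; have [zs bzs Gzs] := Gk; exists zs; first exact: nest.
  apply: le_trans Gzs.
  have := Lam_growth f s1_gt1 al_bound j (k - j) (phi zs).
  rewrite subnKC // -/(Lam _ _) -/(Lam _ _) => growth.
  apply: (@le_trans _ _ (Lam j (phi zs) * s1 ^+ (k - j) * sc (B n.+1))); last first.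
    by rewrite ler_pM2r.
  rewrite -mulrA ler_pM2l //.
  have sNk : s1 ^+ N <= s1 ^+ (k - j) by rewrite ler_weXn2l ?ltW // ltnW.
  apply: (@le_trans _ _ (s1 ^+ N * sc (B n.+1))); last by rewrite ler_pM2r.
  have b1 := (play n).1.
  have s10 : 0 < s1 ^+ N by rewrite exprn_gt0 //; lra.
  have : s1 ^+ N * (beta * (B n).2) <= s1 ^+ N * (B n.+1).2 by rewrite ler_pM2l.
  have : (B n).2 <= beta * s1 ^+ N * (B n).2 by rewrite ler_peMl // ltW.
  move=> c1 c2; rewrite /sc mulrCA ler_pM2l ?mulr_gt0 //; lra.
(* Being threatened in [B n], the point [z] is removed by Alice's move there, although it lies in
   [B n.+1]. *)
have Tz : T (B n) z.
  split => //; exists k; split => //; exists (Ordinal kjN).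
  by have := Vj (Ordinal kjN); rewrite /= -iterD subnK.
have [_] := (play n).2 _ (zB n.+1); apply.
apply: T_small => //; case: xgetP => // H.
by have := H z.
Qed.

End Game.

(** * Charts of a compact manifold *)

Section Charts.
Variables (R : realType) (d : nat) (M : topologicalType) (c : chart R d M).

Lemma chart_img_dom x : chart_dom c x -> chart_img c (c x).
Proof. by move=> xc; exists x. Qed.

Lemma nbhs_chart x0 e : chart_dom c x0 -> 0 < e ->
  nbhs x0 [set x | chart_dom c x /\ `|c x0 - c x| < e].
Proof.
move=> x0c e0; apply: filterI.
  by apply: open_nbhs_nbhs; split => //; exact: chart_dom_open.
exact: (chart_fun_continuous x0c (nbhs_dist_lt _ e0)).
Qed.

Lemma chart_near x0 A : chart_dom c x0 -> nbhs x0 A ->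
  exists2 e : R, 0 < e & forall p, `|c x0 - p| < e ->
    exists w, [/\ chart_dom c w, c w = p & A w].
Proof.
move=> x0c; rewrite -[in nbhs x0](chart_funK x0c) => x0A.
have imgx0 := chart_img_dom x0c.
have inv_cont : nbhs (c x0) (chart_inv c @^-1` A).
  exact: chart_inv_continuous imgx0 _ x0A.
have img_nbhs : nbhs (c x0) (chart_img c).
  by apply: open_nbhs_nbhs; split => //; exact: chart_img_open.
have [e e0 He] := nbhs_dist_ex (filterI inv_cont img_nbhs).
exists e => // p /He[] /= Ap [w wc wp]; exists w; split=> //.
by move: Ap; rewrite -wp (chart_funK wc).
Qed.

Lemma chart_inj x x' : chart_dom c x -> chart_dom c x' -> c x = c x' -> x = x'.
Proof. by move=> xc x'c xx'; rewrite -(chart_funK xc) xx' chart_funK. Qed.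

End Charts.

(** * Uniform estimates on finitely many closed pieces of charts *)

Section Family.
Variables (R : realType) (d : nat) (M : smooth_manifold R d).
Variables (g : riemannian_metric M) (theta : R) (f : M -> M).
Variables (I : finType) (ch : I -> chart R d M) (K : I -> set M).
Hypothesis Mcpt : compact [set: M].
Hypothesis theta_gt0 : 0 < theta.
Hypothesis f_C1 : C1_holder theta f.
Hypothesis ch_atlas : forall i, atlas M (ch i).
Hypothesis K_closed : forall i, closed (K i).
Hypothesis K_dom : forall i, K i `<=` chart_dom (ch i).

(** The single number [e] can act as a radius and, through [e^-1], as a bound. *)
Lemma closed_family_uniform (J : finType) (L : J -> set M)
    (P : J -> R -> M -> Prop) : (forall j, closed (L j)) ->
  (forall j x0, L j x0 -> exists2 U, nbhs x0 U & exists2 e0 : R, 0 < e0 &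
     forall x e, U x -> L j x -> 0 < e -> e <= e0 -> P j e x) ->
  exists2 e : R, 0 < e & forall j x, L j x -> P j e x.
Proof.
move=> Lcl loc; apply: near_right_ex; apply: filter_forall => j.
apply: compact_uniform_near; last exact: loc.
exact: subclosed_compact (Lcl j) Mcpt _.
Qed.

Lemma posdef_metric i x : K i x -> posdef (g (ch i) (ch i x)).
Proof.
move=> Kx; have px := chart_img_dom (K_dom Kx).
split; first exact: (Defs.metric_sym g (ch_atlas i) px).
by move=> v v0; exact: (Defs.metric_posdef g (ch_atlas i) px).
Qed.

Lemma tangent_norm_equiv : exists2 A : R, 0 < A & forall i x, K i x ->
  forall v, `|v| <= A * tangent_norm g (ch i) x v /\
            tangent_norm g (ch i) x v <= A * `|v|.
Proof.
have [|e e0 He] := @closed_family_uniform I K (fun i e x =>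
  forall v, `|v| <= e^-1 * tangent_norm g (ch i) x v /\
            tangent_norm g (ch i) x v <= e^-1 * `|v|) K_closed; last first.
  by exists e^-1 => //; rewrite invr_gt0.
move=> i x0 Kx0; have x0c := K_dom Kx0.
have [|e1 [A [e10 A0] HA]] := @gnorm_equiv_near R d (g (ch i)) (ch i x0) _ (posdef_metric Kx0).
  exact: (metric_smooth g (ch_atlas i) 0%N _ (chart_img_dom x0c)).
exists [set x | chart_dom (ch i) x /\ `|ch i x0 - ch i x| < e1].
  exact: nbhs_chart.
exists A^-1 => [|x e [_ xe1] _ e0 eA v]; first by rewrite invr_gt0.
have [H1 H2] := HA _ xe1 v.
have Ae : A <= e^-1 by rewrite -[A]invrK lef_pV2 ?posrE ?invr_gt0.
split.
  by apply: (le_trans H1); rewrite ler_wpM2r // sqrtr_ge0.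
by apply: (le_trans H2); rewrite ler_wpM2r.
Qed.

(** The derivative is frozen at [x]. Along the coordinate segment from [b] to [a], which stays
    within [s] of [x], the Hölder condition controls its variation; the mean value inequality then
    yields an error proportional to the difference of [a] and [b], that is, a relative error. *)
Lemma differential_estimate : exists2 e : R, 0 < e & forall i i' x,
  K i x -> K i' (f x) -> forall a b s, chart_dom (ch i) a -> chart_dom (ch i) b ->
  `|ch i a - ch i x| <= s -> `|ch i b - ch i x| <= s -> s <= e ->
  [/\ chart_dom (ch i') (f a), chart_dom (ch i') (f b) &
   `|ch i' (f a) - ch i' (f b) - tangent_map f (ch i) (ch i') x (ch i a - ch i b)|
     <= e^-1 * s `^ theta * `|ch i a - ch i b| ].
Proof.
have [f_cont Cf] := f_C1.
have [|j x0 [/= Kx0 Kfx0]|e e0 He] := @closed_family_uniform (I * I)%type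
  (fun j => K j.1 `&` f @^-1` K j.2) (fun j e x =>
  forall a b s, chart_dom (ch j.1) a -> chart_dom (ch j.1) b ->
  `|ch j.1 a - ch j.1 x| <= s -> `|ch j.1 b - ch j.1 x| <= s -> s <= e ->
  [/\ chart_dom (ch j.2) (f a), chart_dom (ch j.2) (f b) &
   `|ch j.2 (f a) - ch j.2 (f b) -
      tangent_map f (ch j.1) (ch j.2) x (ch j.1 a - ch j.1 b)|
     <= e^-1 * s `^ theta * `|ch j.1 a - ch j.1 b| ]).
- move=> j; apply: closedI; first exact: K_closed.
  by apply: preimage_closed => // x _; exact: f_cont.
- move: j Kx0 Kfx0 => [i i'] /= Kx0 Kfx0.
  have [x0c fx0c'] := (K_dom Kx0, K_dom Kfx0).
  have [[Fdiff _] Fhol] := Cf _ _ (ch_atlas i) (ch_atlas i').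
  set c := ch i in x0c Fdiff Fhol *; set c' := ch i' in fx0c' Fdiff Fhol *.
  set F := local_expr f c c' in Fdiff Fhol *.
  set V := chart_dom c `&` f @^-1` chart_dom c' in Fdiff Fhol.
  have FE x : chart_dom c x -> F (c x) = c' (f x).
    by move=> xc; rewrite /F /local_expr /= chart_funK.
  have V_nbhs : nbhs x0 V.
    apply: filterI; first by apply: open_nbhs_nbhs; split => //; exact: chart_dom_open.
    by apply: f_cont; apply: open_nbhs_nbhs; split => //; exact: chart_dom_open.
  have [|C [N [x0N HC]]] := Fhol (c x0); first by exists x0.
  have [e1 e10 He1] := nbhs_dist_ex x0N.
  have [e2 e20 He2] := chart_near x0c V_nbhs.
  pose e3 : R := Num.min e1 e2.
  have e30 : 0 < e3 by rewrite lt_min e10.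
  have inV p : `|c x0 - p| < e3 -> ((c @` V) `&` N) p.
    rewrite lt_min => /andP[pe1 pe2]; split; last exact: He1.
    by have [w [_ wp Vw]] := He2 _ pe2; exists w.
  exists [set x | chart_dom c x /\ `|c x0 - c x| < e3 / 2].
    by apply: nbhs_chart => //; rewrite divr_gt0.
  (* Points within [e3 / 4] of [x], itself within [e3 / 2] of [x0], stay in the ball of radius [e3],
     where the Hölder bound holds and [f] maps into the second chart. *)
  exists (Num.min (e3 / 4) (`|C| + 1)^-1) => [|x e [xc xe] _ e0].
    by rewrite lt_min divr_gt0 // invr_gt0 ltr_wpDl.
  rewrite le_min => /andP[ee3 eC] a b s ac bc xa xb se.
  have near_x p : `|p - c x| <= s -> `|c x0 - p| < e3.
    move=> px; have := ler_normD (c x0 - c x) (c x - p).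
    by rewrite addrA subrK (distrC (c x) p); lra.
  have dom_f w : chart_dom c w -> `|c w - c x| <= s -> chart_dom c' (f w).
    move=> wc /near_x/inV[[w' [w'c fw'] ww'] _].
    by rewrite -(chart_inj w'c wc ww').
  split; [exact: dom_f|exact: dom_f|].
  have s0 : 0 <= s := le_trans (normr_ge0 _) xa.
  have Ce : `|C| <= e^-1.
    have C1 : 0 < `|C| + 1 by rewrite ltr_wpDl.
    have : `|C| + 1 <= e^-1 by rewrite -[leLHS]invrK lef_pV2 ?posrE ?invr_gt0.
    by lra.
  have seg (t : R) : 0 <= t <= 1 -> `|c b + t *: (c a - c b) - c x| <= s.
    move=> /andP[t0 t1].
    have -> : c b + t *: (c a - c b) - c x = t *: (c a - c x) + (1 - t) *: (c b - c x).
      rewrite !scalerBr !scalerBl !scale1r.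
      by apply/rowP => k; rewrite !mxE; ring.
    apply: (le_trans (ler_normD _ _)); rewrite !normrZ !ger0_norm ?subr_ge0 //.
    have := ler_wpM2l t0 xa; have := ler_wpM2l (_ : 0 <= 1 - t) xb; lra.
  rewrite -(FE a ac) -(FE b bc); apply: mean_value_ineq.
  - by rewrite !mulr_ge0 ?powR_ge0 // invr_ge0 ltW.
  - by move=> t /seg/near_x/inV[? _]; exact: Fdiff.
  move=> t /seg tx.
  apply: (le_trans (HC _ (c x) _ (inV _ (near_x _ tx)) (inV _ _))).
    by apply: lt_trans xe _; lra.
  rewrite ler_wpM2r //; apply: (@le_trans _ _ (`|C| * s `^ theta)).
    apply: (@le_trans _ _ (`|C| * `|c b + t *: (c a - c b) - c x| `^ theta)).
      by rewrite ler_wpM2r ?powR_ge0 // ler_norm.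
    by rewrite ler_wpM2l // ge0_ler_powR ?nnegrE // ltW.
  by rewrite ler_wpM2r ?powR_ge0.
by exists e => // i i' x Kx Kfx; exact: (He (i, i') x (conj Kx Kfx)).
Qed.

Variables (s1 s2 : R) (J : M -> I).
Hypothesis s1_gt1 : 1 < s1.
Hypothesis s1_le_s2 : s1 <= s2.
Hypothesis f_exp : forall x c c', atlas M c -> atlas M c' ->
  chart_dom c x -> chart_dom c' (f x) -> forall v,
  s1 * tangent_norm g c x v <= tangent_norm g c' (f x) (tangent_map f c c' x v)
    <= s2 * tangent_norm g c x v.
Hypothesis f_conf : conformal g f.
Hypothesis J_cover : forall x, K (J x) x.

(** This replaces a Riemannian distance near [x]. Coordinates and metric are frozen at [x], so that
    the step from [x] to [f x] involves only the derivative at [x]. *)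
Let Q x a b := tangent_norm g (ch (J x)) x (ch (J x) a - ch (J x) b).
Let dm x a := chart_dom (ch (J x)) a.

Lemma J_dom x : chart_dom (ch (J x)) x.
Proof. exact: K_dom (J_cover x). Qed.

Lemma conformal_factor : exists al : M -> R, (forall x, s1 <= al x <= s2) /\
  forall x v, tangent_norm g (ch (J (f x))) (f x)
      (tangent_map f (ch (J x)) (ch (J (f x))) x v) =
    al x * tangent_norm g (ch (J x)) x v.
Proof.
suff /choice[al Hal] x : exists al, (s1 <= al <= s2) /\ forall v,
    tangent_norm g (ch (J (f x))) (f x)
      (tangent_map f (ch (J x)) (ch (J (f x))) x v) =
    al * tangent_norm g (ch (J x)) x v.
  by exists al; split=> x; have [] := Hal x.
have [a [T [T_iso T_map]]] :=
  f_conf (ch_atlas _) (ch_atlas _) (J_dom x) (J_dom (f x)).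
have scaled v : tangent_norm g (ch (J (f x))) (f x)
    (tangent_map f (ch (J x)) (ch (J (f x))) x v) =
    `|a| * tangent_norm g (ch (J x)) x v.
  by rewrite T_map -T_iso /tangent_norm -/(gnorm _ _) gnormZ.
have [[v v0]|nov] := pselect (exists v : 'rV[R]_d, v != 0).
  exists `|a|; split=> //.
  have := f_exp (ch_atlas _) (ch_atlas _) (J_dom x) (J_dom (f x)) v.
  rewrite scaled; have v_gt0 : 0 < tangent_norm g (ch (J x)) x v.
    by rewrite sqrtr_gt0; apply: (posdef_metric (J_cover x)).2.
  by rewrite !ler_pM2r.
(* In dimension zero no nonzero vector pins down [a], and [s1] is taken as the factor. *)
exists s1; split=> [|v]; first by rewrite lexx.
have v0 : v = 0 by apply: contrapT => /eqP v0; apply: nov; exists v.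
rewrite scaled v0 -(scale0r (0 : 'rV[R]_d)) /tangent_norm.
by rewrite -/(gnorm (g (ch (J x)) (ch (J x) x)) _) gnormZ normr0 !mul0r !mulr0.
Qed.

Lemma conformal_step (al : M -> R) :
  (forall x v, tangent_norm g (ch (J (f x))) (f x)
      (tangent_map f (ch (J x)) (ch (J (f x))) x v) =
    al x * tangent_norm g (ch (J x)) x v) ->
  exists C r : R, [/\ 0 <= C, 0 < r & forall x a b s, s <= r ->
    dm x a -> dm x b -> Q x a x <= s -> Q x b x <= s ->
    [/\ dm (f x) (f a), dm (f x) (f b) &
      `|Q (f x) (f a) (f b) - al x * Q x a b| <= C * s `^ theta * Q x a b]].
Proof.
move=> Hal.
have [A A0 HA] := tangent_norm_equiv.
have [e e0 He] := differential_estimate.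
(* The constant [A] enters three times: in the radius [A * s], in passing to the norm at [f x], and
   in returning from coordinates to [Q]. *)
exists (A * (e^-1 * A `^ theta) * A), (e / A); split.
- by rewrite !mulr_ge0 ?(ltW A0) ?powR_ge0 // invr_ge0 ltW.
- exact: divr_gt0.
move=> x a b s sr da db Qa Qb.
have s0 : 0 <= s := le_trans (sqrtr_ge0 _) Qa.
have close w : Q x w x <= s -> `|ch (J x) w - ch (J x) x| <= A * s.
  by move=> Qw; apply: (le_trans (HA _ _ (J_cover x) _).1); rewrite ler_pM2l.
have As : A * s <= e by move: sr; rewrite ler_pdivlMr // mulrC.
have [dfa dfb est] := He _ _ _ (J_cover x) (J_cover (f x)) a b (A * s)
  da db (close _ Qa) (close _ Qb) As.
split=> //; rewrite -Hal.
have Gpos := posdef_metric (J_cover (f x)).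
apply: (le_trans (gnorm_dist Gpos _ _)).
apply: (le_trans (HA _ _ (J_cover (f x)) _).2).
have [HQ _] := HA _ _ (J_cover x) (ch (J x) a - ch (J x) b).
rewrite -!mulrA ler_pM2l //; apply: (le_trans est).
rewrite powRM ?(ltW A0) // -!mulrA.
rewrite !ler_wpM2l ?powR_ge0 // ?invr_ge0 ?(ltW e0) //.
by rewrite mulrCA ler_wpM2l ?powR_ge0.
Qed.

(** Regularity gives a [W] whose closure misses [Z]; as [Z] is compact, coordinate balls of one
    uniform radius about its points miss [W]. *)
Lemma point_away_from_closed p (Z : set M) : closed Z -> ~ Z p ->
  exists2 delta : R, 0 < delta & exists2 W : set M, nbhs p W &
  forall i x w, K i x -> Z x -> W w -> chart_dom (ch i) w ->
    ~ tangent_norm g (ch i) x (ch i w - ch i x) <= delta.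
Proof.
move=> Zcl Zp; have [A A0 HA] := tangent_norm_equiv.
have [W pW WZ] : exists2 W, nbhs p W & closure W `<=` ~` Z.
  have reg := compact_regular (@carrier_hausdorff _ _ M) Mcpt (filterT : nbhs p setT).
  have : nbhs p (~` Z) by apply: open_nbhs_nbhs; split=> //; exact: closed_openC.
  by move=> /reg[W pW WZ]; exists W.
have [|i x0 [Kx0 Zx0]|e e0 He] := @closed_family_uniform I (fun i => K i `&` Z)
  (fun i e x => forall w, chart_dom (ch i) w ->
     tangent_norm g (ch i) x (ch i w - ch i x) <= e -> ~ W w).
- by move=> i; exact: closedI.
- have x0c := K_dom Kx0.
  have : nbhs x0 (~` closure W).
    apply: open_nbhs_nbhs; split; first exact/closed_openC/closed_closure.
    by move=> /WZ.
  move=> /(chart_near x0c)[e e0 He].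
  exists [set x | chart_dom (ch i) x /\ `|ch i x0 - ch i x| < e / 2].
    by apply: nbhs_chart => //; rewrite divr_gt0.
  exists (e / 2 / A) => [|x e' [xc xe] [Kx _] e'0 e'e w wc Qw Ww].
    by rewrite !divr_gt0.
  have [H _] := HA _ _ Kx (ch i w - ch i x).
  have wx : `|ch i w - ch i x| <= e / 2.
    apply: (le_trans H); rewrite mulrC -ler_pdivlMr //.
    exact: le_trans Qw e'e.
  have [|w' [w'c ww' ]] := He (ch i w).
    have := ler_normD (ch i x0 - ch i x) (ch i x - ch i w).
    by rewrite addrA subrK (distrC (ch i x)); lra.
  by apply; rewrite (chart_inj w'c wc ww'); exact: subset_closure.
exists e => //; exists W => // i x w Kx Zx Ww wc Qw.
exact: (He i x (conj Kx Zx) w wc Qw Ww).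
Qed.

(** For equal points, [W] is made small in the coordinates of each piece containing [p], while
    points of the other pieces do not see [W] at all. For distinct points take disjoint open
    neighbourhoods: [x] lies outside one of them and cannot see both points. *)
Lemma gauge_separated p p' : \forall delta \near 0^'+, separated Q dm p p' delta.
Proof.
have [A A0 HA] := tangent_norm_equiv.
have [<-|pp'] := pselect (p = p').
  (* The scale [delta] comes before [r], and the piece used at [x] varies with [x]; hence each piece
     is treated on its own. *)
  pose small i (delta : R) := forall r : R, 0 < r ->
      exists W : set M, nbhs p W /\ forall x w w', K i x -> W w -> W w' ->
        chart_dom (ch i) w -> chart_dom (ch i) w' ->
        tangent_norm g (ch i) x (ch i w - ch i x) <= delta ->
        tangent_norm g (ch i) x (ch i w - ch i w') < r.
  have local i : \forall delta \near (0:R)^'+, small i delta.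
    have [Kp|Kp] := pselect (K i p); last first.
      have [delta d0 [W pW HW]] := point_away_from_closed (@K_closed i) Kp.
      apply: (near_right_le d0) => e e0 ed r r0; exists W; split=> //.
      move=> x w w' Kx Ww _ wc _ /le_trans/(_ ed) Qw.
      by case: (HW i x w Kx Kx Ww wc).
    apply: (near_right_le ltr01) => e _ _ r r0.
    exists [set w | chart_dom (ch i) w /\ `|ch i p - ch i w| < r / (2 * A)].
    split; first by apply: nbhs_chart; [exact: K_dom|rewrite divr_gt0 ?mulr_gt0].
    move=> x w w' Kx [_ pw] [_ pw'] _ _ _.
    apply: (le_lt_trans (HA _ _ Kx _).2).
    have := ler_normD (ch i w - ch i p) (ch i p - ch i w').
    rewrite addrA subrK (distrC (ch i w) (ch i p)) => H.
    move: pw pw'; rewrite !ltr_pdivlMr ?mulr_gt0 // => pw pw'.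
    have : A * `|ch i w - ch i w'| <= A * (`|ch i p - ch i w| + `|ch i p - ch i w'|).
      by rewrite ler_pM2l.
    lra.
  near=> delta => r r0.
  have delta_small i : small i delta.
    by move: i; near: delta; exact: filter_forall.
  have /choice[W HW] i := delta_small i r r0.
  have pW : nbhs p [set w | forall i, W i w].
    by apply: filter_forall => i; have [] := HW i.
  exists [set w | forall i, W i w], [set w | forall i, W i w].
  split=> // x w w' Ww Ww' wc w'c Qw _.
  by have [_] := HW (J x); apply => //; exact: J_cover.
have := @carrier_hausdorff _ _ M; rewrite open_hausdorff => /(_ p p').
move=> /(_ (introN eqP pp'))[[V V'] /=]; rewrite !inE => -[pV p'V'] [Vo V'o VV'].
have [||e e0 [W pW HW]] := @point_away_from_closed p (~` V).
- exact: open_closedC.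
- by apply.
have [||e' e'0 [W' p'W' HW']] := @point_away_from_closed p' (~` V').
- exact: open_closedC.
- by apply.
apply: (@near_right_le _ _ (Num.min e e')); first by rewrite lt_min e0.
move=> delta _; rewrite le_min => /andP[de de'] r r0.
exists W, W'; split=> // x w w' Ww W'w' wc w'c Qw Qw'.
have [Vx|Vx] := pselect (V x); last first.
  by case: (HW _ _ _ (J_cover x) Vx Ww wc (le_trans Qw de)).
case: (HW' _ _ _ (J_cover x) _ W'w' w'c (le_trans Qw' de')) => V'x.
by suff : set0 x by []; rewrite -VV'.
Unshelve. all: by end_near. Qed.

End Family.

(** * From the abstract game to the charts of the manifold *)

Section Winning.
Variables (R : realType) (d : nat) (M : smooth_manifold R d).
Variables (g : riemannian_metric M) (theta : R) (f : M -> M) (y : M).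
Hypothesis Mcpt : compact [set: M].
Hypothesis theta_gt0 : 0 < theta.
Hypothesis f_exp : expanding_endomorphism g theta f.
Hypothesis f_conf : conformal g f.

(** A compact Hausdorff space is regular, so every point has a closed neighbourhood inside a chart;
    compactness leaves finitely many. *)
Lemma closed_chart_cover : exists (D : seq M) (ch : M -> chart R d M)
  (K : M -> set M), [/\ forall p, atlas M (ch p), forall p, closed (K p),
    forall p, K p `<=` chart_dom (ch p) & forall x, exists2 p, p \in D & K p x].
Proof.
have /choice[cK HcK] (p : M) : exists cK : chart R d M * set M,
    [/\ atlas M cK.1, closed cK.2, cK.2 `<=` chart_dom cK.1 & nbhs p cK.2].
  have [c catlas pc] := atlas_cover p.
  have reg := compact_regular (@carrier_hausdorff _ _ M) Mcpt (filterT : nbhs p setT).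
  have : nbhs p (chart_dom c).
    by apply: open_nbhs_nbhs; split=> //; exact: chart_dom_open.
  move=> /reg[W pW Wc]; exists (c, closure W); split=> //=.
    exact: closed_closure.
  by apply: filterS pW; exact: subset_closure.
have [|D HD] := compact_finite_nbhs_cover (K := fun p => (cK p).2) Mcpt.
  by move=> p; have [] := HcK p.
exists D, (fun p => (cK p).1), (fun p => (cK p).2).
by split=> [p|p|p|]; [case: (HcK p)|case: (HcK p)|case: (HcK p)|exact: HD].
Qed.

Lemma chart_inv_ball_closed (c : chart R d M) (b : 'rV[R]_d * R) :
  cball b `<=` chart_img c -> closed (chart_inv c @` cball b).
Proof.
move=> bc; apply: compact_closed; first exact: carrier_hausdorff.
apply: continuous_compact; last exact: cball_compact.
apply: continuous_in_subspaceT => p; rewrite inE => bp.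
exact: chart_inv_continuous (bc _ bp).
Qed.

Lemma winning_from_ball (c : chart R d M) (b0 : 'rV[R]_d * R) (beta : R) :
  atlas M c -> 0 < b0.2 -> cball b0 `<=` chart_img c -> 0 < beta ->
  exists2 sigma : strategy R d, legal_strategy beta sigma &
    forall U B, B 0%N = b0 -> legal_play beta U sigma B ->
    exists2 z, (forall n, cball (B n) z) & orbit_avoiding f y (chart_inv c z).
Proof.
move=> c_atlas b0_gt0 b0c beta_gt0.
have [f_C1 [s1 [s2 [s1_gt1 s1_le_s2 f_bound]]]] := f_exp.
have [D [ch' [K' [ch'_atlas K'_closed K'_dom K'_cover]]]] := closed_chart_cover.
(* The index [None] adds the chart of the game, with Bob's first ball as its closed piece. *)
pose I := option (seq_sub D).
pose ch (i : I) := if i is Some p then ch' (val p) else c.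
pose K (i : I) := if i is Some p then K' (val p) else chart_inv c @` cball b0.
have invK z : cball b0 z -> chart_dom c (chart_inv c z) /\ c (chart_inv c z) = z.
  by move=> /b0c[x xc <-]; rewrite chart_funK.
have ch_atlas i : atlas M (ch i) by case: i => [p|]; [exact: ch'_atlas|exact: c_atlas].
have K_closed i : closed (K i) by case: i => [p|]; [exact: K'_closed|exact: chart_inv_ball_closed].
have K_dom i : K i `<=` chart_dom (ch i).
  by case: i => [p|] /=; [exact: K'_dom|move=> _ [z /invK[? _] <-]].
(* Preferring [None] makes [Q] at points of the first ball use the coordinates of the game, where it
   is comparable with the Euclidean norm. *)
have /choice[J HJ] x : exists i, K i x /\ (K None x -> i = None).
  have [Kx|Kx] := pselect (K None x); first by exists None.
  have [p pD Kp] := K'_cover x.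
  by exists (Some (SeqSub pD)).
have J_cover x : K (J x) x by have [] := HJ x.
have JN z : cball b0 z -> J (chart_inv c z) = None.
  by move=> bz; have [_] := HJ (chart_inv c z); apply; exists z.
have [A A0 HA] := tangent_norm_equiv g Mcpt ch_atlas K_closed K_dom.
have [al [al_bound al_norm]] :=
  conformal_factor ch_atlas K_dom s1_le_s2 f_bound f_conf J_cover.
have [C [r [C0 r0 step]]] := conformal_step Mcpt theta_gt0 f_C1 ch_atlas K_closed
  K_dom J_cover al_norm.
pose Q x a b := tangent_norm g (ch (J x)) x (ch (J x) a - ch (J x) b).
pose dm x a := chart_dom (ch (J x)) a.
apply: (@game_won R d M f y Q dm al s1 s2 beta (d.+1%:R * A) b0 (chart_inv c)) => //.
- by case: f_C1.
- by rewrite mulr_gt0.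
- by move=> z a bz ba; rewrite /dm JN //=; have [] := invK a ba.
- move=> z a b bz ba bb; rewrite /Q JN //= (invK a ba).2 (invK b bb).2.
  have Kz : K None (chart_inv c z) by exists z.
  have [H1 H2] := HA None _ Kz (a - b); split.
    by apply: (le_trans (enorm_le_norm _)); rewrite -mulrA ler_pM2l.
  apply: (le_trans H2); rewrite (mulrC d.+1%:R) -mulrA ler_pM2l //.
  apply: (le_trans (norm_le_enorm _)); rewrite ler_peMl ?enorm_ge0 //.
  by rewrite ler1n.
- apply: (bounded_distortion s1_gt1 al_bound theta_gt0 C0 r0 (Q := Q) (dm := dm)).
  + by move=> x; exact: K_dom (J_cover x).
  + by move=> x a b; exact: sqrtr_ge0.
  + move=> x; rewrite /Q subrr -(scale0r (0 : 'rV[R]_d)) /tangent_norm.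
    by rewrite -/(gnorm (g (ch (J x)) (ch (J x) x)) _) gnormZ normr0 mul0r.
  + exact: step.
- by move=> p p'; apply: gauge_separated.
Qed.

(** The constants depend on Bob's first ball. A strategy sees the whole history, so it can look this
    ball up and follow the strategy made for it. *)
Lemma winning_in_chart (c : chart R d M) : atlas M c ->
  absolute_winning_on (chart_img c) (c @` (orbit_avoiding f y `&` chart_dom c)).
Proof.
move=> c_atlas beta beta_gt0 _.
have /choice[Sigma HSigma] (b0 : 'rV[R]_d * R) : exists sigma : strategy R d,
    legal_strategy beta sigma /\
    (0 < b0.2 -> cball b0 `<=` chart_img c ->
      forall U B, B 0%N = b0 -> legal_play beta U sigma B ->
      exists2 z, (forall n, cball (B n) z) & orbit_avoiding f y (chart_inv c z)).
  have [[b0_gt0 b0c]|bad] := pselect (0 < b0.2 /\ cball b0 `<=` chart_img c).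
    have [sigma ? ?] := winning_from_ball c_atlas b0_gt0 b0c beta_gt0.
    by exists sigma.
  (* For a first ball that Bob may not choose, only legality matters. *)
  exists (fun s => (0, beta * (last b0 s).2)); split=> [s b bgt0|b0_gt0 b0c].
    by rewrite /= last_rcons mulr_gt0 // lexx.
  by case: bad.
exists (fun s => Sigma (head (0, 0) s) s) => [s b|B [B0 Bc play]].
  by have [H _] := HSigma (head (0, 0) (rcons s b)); exact: H.
have [_ /(_ B0 Bc (chart_img c) B erefl)[|z zB Ez]] := HSigma (B 0%N).
  by split=> // i; exact: play.
have [x xc xz] := Bc _ (zB 0%N).
exists z; split=> [n _|]; first exact: zB.
exists (chart_inv c z); last by rewrite -xz chart_funK.
by split=> //; rewrite -xz chart_funK.
Qed.

End Winning.

Unset Implicit Arguments.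
Set Strict Implicit.

Theorem theorem1p2 (R : realType) (d : nat) (M : smooth_manifold R d)
    (g : riemannian_metric M) (theta : R) (f : M -> M) (y : M) :
  compact [set: M] ->
  0 < theta ->
  expanding_endomorphism g theta f ->
  conformal g f ->
  absolute_winning (orbit_avoiding f y).
Proof.
move=> Mcpt theta_gt0 f_exp f_conf; exists (atlas M); split.
- by move=> c ca c' c'a; exact: atlas_compatible.
- by move=> x; exact: atlas_cover.
- by move=> c ca; exact: (winning_in_chart y Mcpt theta_gt0 f_exp f_conf ca).
Qed.
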